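(* Fix $K \in \mathcal{K}$ and $a \geq 0$. Let $Q$ be a probability measure on $[a,\infty)$. (i) If $\int_{[a,\infty)} r\,dQ(r) = \infty$, then $L(\phi,Q) = -\infty$ for all $\phi \in \Phi_a$. (ii) If $Q(\{a\}) = 1$, then $\sup_{\phi \in \Phi_a} L(\phi,Q) = \infty$. (iii) If $Q \in \mathcal{Q}_a$, then $\sup_{\phi \in \Phi_a} L(\phi,Q) \in \mathbb{R}$, and $\phi_a^*(Q) := \mathrm{argmax}_{\phi \in \Phi_a} L(\phi,Q)$ is well-defined (the maximum is attained at a unique $\phi\in\Phi_a$), so that $\phi_a^*$ is a well-defined map from $\mathcal{Q}_a$ to $\Phi_a$. (iv) If $P$ is a probability measure on $\mathbb{R}^p$ and we define a probability measure $Q$ on $[0,\infty)$ by $Q([0,r)) := P(\{x : \|x\|_K < r\})$, then $\mathcal{L}(\phi,P) = L_0(\phi,Q)$ for every $\phi \in \Phi$, where $L_0$ denotes $L$ with $a=0$. In particular, if $P \in \mathcal{P}_p$, then $Q \in \mathcal{Q}_0$ and $\varphi^*(P) = \phi_0^*(Q)$, where $\varphi^*(P) := \mathrm{argmax}_{\phi\in\Phi}\mathcal{L}(\phi,P)$.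
   Context: $\mathcal{K}$ is the set of compact, convex sets $K \subseteq \mathbb{R}^p$ with $0 \in \mathrm{int}(K)$; $\|x\|_K := \inf\{t \in [0,\infty) : x \in tK\}$; $\lambda_p$ is Lebesgue measure on $\mathbb{R}^p$. $\Phi = \Phi_0$ is the set of upper semi-continuous, concave, decreasing (i.e. non-increasing) functions $\phi:[0,\infty) \to [-\infty,\infty)$, with $e^{-\infty}:=0$, and for $a \geq 0$, $\Phi_a := \{\phi(\cdot - a) : \phi \in \Phi\}$ (functions on $[a,\infty)$). For a probability measure $Q$ on $[a,\infty)$ and $\phi \in \Phi_a$, $$L(\phi,Q) := \int_{[a,\infty)} \phi\,dQ - p\lambda_p(K)\int_a^\infty r^{p-1}e^{\phi(r)}\,dr + 1.$$ For a probability measure $P$ on $\mathbb{R}^p$ and $\phi \in \Phi$, $$\mathcal{L}(\phi,P) := \int_{\mathbb{R}^p}\phi(\|x\|_K)\,dP(x) - p\lambda_p(K)\int_0^\infty r^{p-1}e^{\phi(r)}\,dr + 1.$$ $\mathcal{P}_p$ is the set of probability distributions $P$ on $\mathbb{R}^p$ with $\int \|x\|_K\,dP(x) < \infty$ and $P(\{0\}) < 1$. $\mathcal{Q}_a$ is the class of probability measures $Q$ on $[a,\infty)$ with $\int r\,dQ(r) < \infty$ and $Q(\{a\}) < 1$. *)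

(* Defs.v *)
(* MathComp-Analysis *)
From mathcomp Require Import all_boot all_order all_algebra.
From mathcomp Require Import all_classical all_reals all_analysis.

Set Implicit Arguments.
Unset Strict Implicit.
Unset Printing Implicit Defensive.

Import Order.TTheory GRing.Theory Num.Theory.
Import numFieldNormedType.Exports.

Local Open Scope classical_set_scope.
Local Open Scope ring_scope.

Section euclidean_space.
Context {R : realType} {p : nat}.
Implicit Types (K A : set 'rV[R]_p).

(* 'rV[R]_p carries the product topology; [0 < p] is required separately. *)
Definition convex_body K : Prop :=
  [/\ compact K, convex_set K & K° 0].

Definition gauge_norm K (x : 'rV[R]_p) : R :=
  inf [set t | 0 <= t /\ [set t *: y | y in K] x].

Definition box (u v : 'rV[R]_p) : set 'rV[R]_p :=
  [set x | forall i, u ord0 i < x ord0 i <= v ord0 i].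

Definition box_volume (u v : 'rV[R]_p) : R :=
  \prod_(i < p) Num.max 0 (v ord0 i - u ord0 i).

(* Lebesgue outer measure: infimum of total volumes of countable covers by
   boxes. On Lebesgue measurable sets, hence on compact ones, it is the
   p-dimensional Lebesgue measure. *)
Definition lebesgue_outer A : \bar R :=
  ereal_inf [set (\sum_(k <oo) (box_volume (B k).1 (B k).2)%:E)%E |
    B in [set B : ('rV[R]_p * 'rV[R]_p)^nat |
          A `<=` \bigcup_k box (B k).1 (B k).2]].

End euclidean_space.

Definition borel_rV (R : realType) (p : nat) :=
  g_sigma_algebraType (@open 'rV[R]_p).

Section functions_on_rays.
Context {R : realType}.
Implicit Types (phi : R -> \bar R) (a : R).

Definition ray a : set R := [set r | a <= r].

(* Upper semi-continuity on [a, oo) for the topology induced from R: points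
   outside [A] are isolated in [subspace A]. *)
Definition usc_on (A : set R) phi : Prop :=
  lower_semicontinuous (fun r : subspace A => (- phi r)%E).

(* A function on [0, oo) is encoded as a total function which is 0 on the
   negative reals, so that Leibniz equality is equality on [0, oo). *)
Definition Phi : set (R -> \bar R) := [set phi |
  [/\ forall r, r < 0 -> phi r = 0%E,
      forall r, 0 <= r -> (phi r < +oo)%E,
      usc_on (ray 0) phi,
      forall r s t, 0 <= r -> 0 <= s -> 0 < t < 1 ->
        (t%:E * phi r + (1 - t)%:E * phi s
           <= phi (t * r + (1 - t) * s)%R)%E &
      forall r s, 0 <= r -> r <= s -> (phi s <= phi r)%E]].

(* Likewise, functions on [a, oo) are extended by 0 to (-oo, a). *)
Definition Phi_ a : set (R -> \bar R) :=
  [set (fun r => phi (r - a)) | phi in Phi].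

End functions_on_rays.

Definition argmax {R : realType} {T : Type} (S : set T) (F : T -> \bar R) :
    set T :=
  [set x | S x /\ forall y, S y -> (F y <= F x)%E].

Section criteria.
Context {R : realType} {p : nat}.
Variable K : set 'rV[R]_p.
Implicit Types (phi : R -> \bar R) (a : R).
Implicit Types (Q : probability (measurableTypeR R) R).
Implicit Types (P : probability (borel_rV R p) R).
Local Open Scope ereal_scope.

Definition mass a phi : \bar R :=
  p%:R%:E * lebesgue_outer K *
  \int[lebesgue_measure]_(r in ray a) ((r ^+ p.-1)%:E * expeR (phi r)).

(* If phi < +oo is decreasing, the first integral is never +oo and the mass is
   nonnegative, so no indeterminate form +oo - +oo arises. *)
Definition L a phi Q : \bar R :=
  \int[Q]_(r in ray a) phi r - mass a phi + 1.

Definition calL phi P : \bar R :=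
  \int[P]_x phi (gauge_norm K x) - mass 0%R phi + 1.

(* Probability measures on [a, oo) are those on R that give it mass 1. *)
Definition prob_on_ray a Q : Prop := Q (ray a) = 1.

Definition class_Q a Q : Prop :=
  [/\ prob_on_ray a Q, \int[Q]_(r in ray a) r%:E < +oo & Q [set a] < 1].

Definition class_P P : Prop :=
  \int[P]_x (gauge_norm K x)%:E < +oo /\ P [set (0%R : 'rV[R]_p)] < 1.

(* Meaningful only when the set of maximisers is a singleton. *)
Definition phi_star a Q : R -> \bar R :=
  get (argmax (Phi_ a) (fun phi => L a phi Q)).

Definition varphi_star P : R -> \bar R :=
  get (argmax Phi (fun phi => calL phi P)).

End criteria.

(* Main.v *)
(* For (iii), write w = exp (phi / 2). If phi1 and phi2 both have criterion at
   least sup L - e, comparing L at their midpoint with sup L shows that the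
   integral of r^(p-1) (w1 - w2)^2 is at most a constant times e. Since the w_i
   decrease, this yields phi1 r <= phi2 s for s < r when e = 0, hence uniqueness,
   and, along a maximizing sequence phi_n, limsup phi_n r <= liminf phi_n s for
   s < r without passing to a subsequence. The upper semicontinuous hull of
   liminf phi_n then dominates limsup phi_n on the ray and coincides with
   liminf phi_n except at one point, so that Fatou's lemma, applied to the
   bounded above integrands phi_n under Q and to exp phi_n under the weighted
   Lebesgue measure, shows that the hull is a maximizer. The bounds needed come
   from Q putting mass q > 0 on some [b, oo) with b > a: a large phi a forces
   either phi b to be so small that the first term is, or phi to be large on an
   interval of length of order 1 / phi a, whose mass beats phi a. In (iv), a law
   on the ray is determined by its values on the half-lines. *)

(* [K] enters only through [c = p * lebesgue_outer K], a positive real because [K] is bounded and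
   has interior. The obstacle is the value [-oo]: a function of [Phi_ a] may drop to [-oo] beyond
   some point, and at the right end of the domain where liminf phi_n is not [-oo], that function can
   lie strictly below its left limit. [Q] may have an atom there, Lebesgue measure has none. The two
   terms of the criterion tolerate this from opposite sides: the [Q] term needs the limit to
   dominate limsup phi_n at every point of the ray, the mass term needs it to be at most liminf
   phi_n only almost everywhere. The other special point is [a], which has no left neighbour in the
   ray: there left continuity and the comparison for s < r say nothing, and concavity together with
   the lower bound at [b] takes over. *)
From HB Require Import structures.
Require Import Defs.
From mathcomp Require Import all_boot all_order all_algebra.
From mathcomp Require Import all_classical all_reals all_analysis.
From mathcomp Require Import measurable_realfun lra ring.

Set Implicit Arguments.
Unset Strict Implicit.
Unset Printing Implicit Defensive.

Import Order.TTheory GRing.Theory Num.Theory.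
Import numFieldNormedType.Exports.

Local Open Scope classical_set_scope.
Local Open Scope ring_scope.
Local Open Scope ereal_scope.

(** * Lebesgue outer measure of a convex body *)

(* Induction on the dimension: the hypothesis is integrated over one coordinate
   at a time, so that only one-dimensional Lebesgue measure is needed. Points are
   sequences, all but the first [m] entries being irrelevant. *)
Lemma box_cover_lower_bound (R : realType) (m : nat) (e c : R) (w : nat -> R)
    (u v : nat -> nat -> R) :
  (0 <= e)%R -> (0 <= c)%R -> (forall k, 0 <= w k)%R ->
  (forall x : nat -> R, (forall i, 0 <= x i <= e)%R ->
    c%:E <= \sum_(k <oo)
      (w k * \prod_(i < m) \1_(`]u k i, v k i]%classic : set R) (x i))%:E) ->
  (c * e ^+ m)%:E
    <= \sum_(k <oo) (w k * \prod_(i < m) Num.max 0 (v k i - u k i))%:E.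
Proof.
move=> e0; elim: m => [|m IH] in c w * => c0 w0 H.
  have := H (fun=> 0%R); rewrite expr0 mulr1.
  under eq_eseriesr do rewrite big_ord0.
  under [in X in _ -> X]eq_eseriesr do rewrite big_ord0.
  by apply => i; rewrite lexx.
rewrite exprS mulrA.
under eq_eseriesr do rewrite big_ord_recr/= (mulrC (\prod_(_ < _) _)%R) mulrA.
(* The length of the last side is absorbed into the weights, which is why the statement carries
   [w]. *)
apply: (IH _ (fun k => w k * Num.max 0 (v k m - u k m))%R).
- exact: mulr_ge0.
- by move=> k; rewrite mulr_ge0// le_max lexx.
move=> x xe.
pose A k : R := (w k * \prod_(i < m) \1_(`]u k i, v k i]%classic : set R) (x i))%R.
have A0 k : (0 <= A k)%R by rewrite mulr_ge0// prodr_ge0.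
have m1 k (D : set R) :
    measurable_fun D
      (EFin \o (fun y : R => A k * \1_(`]u k m, v k m]%classic : set R) y)%R).
  exact/measurable_EFinP/measurable_funM.
pose mu := @lebesgue_measure R.
have -> : (c * e)%:E = \int[mu]_(y in `[0%R, e]) c%:E.
  rewrite integral_cst//= lebesgue_measure_itv/= lte_fin lt_neqAle e0 andbT.
  by case: eqP => [<-|_]; rewrite /= ?mule0 ?mulr0 -?EFinD ?subr0.
apply: (@le_trans _ _ (\int[mu]_(y in `[0%R, e])
    \sum_(k <oo) (A k * \1_(`]u k m, v k m]%classic : set R) y)%:E)).
  apply: ge0_le_integral => //.
  - apply: (@ge0_emeasurable_sum _ _ _ _
      (fun k y => (A k * \1_(`]u k m, v k m]%classic : set R) y)%:E) xpredT).
      by move=> k y ? ?; rewrite lee_fin mulr_ge0.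
    by move=> k ?; exact: m1.
  move=> y; rewrite /= in_itv/= => ye.
  apply: (le_trans (H (fun i : nat => if i == m then y else x i) _)).
    by move=> i; case: ifP.
  apply: lee_nneseries => k _; rewrite lee_fin.
    by rewrite mulr_ge0// prodr_ge0.
  rewrite big_ord_recr/= eqxx /A mulrA ler_wpM2r// ler_wpM2l//.
  by rewrite le_eqVlt; apply/orP; left; apply/eqP/eq_bigr => i _; rewrite ifN ?ltn_eqF.
rewrite integral_nneseries//; last 2 first.
  - by move=> k; exact: m1.
  - by move=> k y _; rewrite lee_fin mulr_ge0.
apply: lee_nneseries => [k _ _|k _].
  by apply: integral_ge0 => y _; rewrite lee_fin mulr_ge0.
under eq_integral do rewrite EFinM.
rewrite ge0_integralZl//; last 2 first.
  - exact/measurable_EFinP.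
  - by rewrite lee_fin.
rewrite integral_indic//.
have -> : (w k * Num.max 0 (v k m - u k m) *
    \prod_(i < m) \1_(`]u k i, v k i]%classic : set R) (x i)
    = A k * Num.max 0 (v k m - u k m))%R by rewrite /A; ring.
rewrite [leRHS]EFinM; apply: lee_wpmul2l; first by rewrite lee_fin.
apply: (@le_trans _ _ (mu `]u k m, v k m]%classic)).
  by apply: le_measure; rewrite ?inE//=; apply: measurableI.
rewrite /mu lebesgue_measure_itv/= lte_fin -EFinD; case: ifPn => h.
  by rewrite lee_fin le_max lexx orbT.
by rewrite lee_fin le_max lexx.
Qed.

Section lebesgue_outer_body.
Context {R : realType} {p : nat}.
Implicit Types K : set 'rV[R]_p.

(** The norm is the sup norm, so a ball of radius [e] inside [K] contains the cube [0, e/2]^p. Each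
    point of the cube lies in some box of the cover, so the indicators sum to at least 1 on it. *)
Lemma lebesgue_outer_gt0 K : K° 0%R -> 0 < lebesgue_outer K.
Proof.
move=> /nbhs_ballP[e /= e0 eK].
pose d := (e / 2)%R.
have d0 : (0 < d)%R by rewrite divr_gt0.
apply: (@lt_le_trans _ _ (d ^+ p)%:E); first by rewrite lte_fin exprn_gt0.
apply: le_ereal_inf_tmp => _ [B KB <-].
pose X (y : 'rV[R]_p) (i : nat) : R := (if insub i is Some j then y ord0 j else 0)%R.
have XE y (i : 'I_p) : X y i = y ord0 i by rewrite /X valK.
have -> : \sum_(k <oo) (box_volume (B k).1 (B k).2)%:E
    = \sum_(k <oo) (1 * \prod_(i < p)
        Num.max 0 (X (B k).2 i - X (B k).1 i))%:E.
  apply: eq_eseriesr => k _; rewrite mul1r; congr _%:E.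
  by apply: eq_bigr => i _; rewrite !XE.
rewrite -[(d ^+ p)%R]mul1r.
apply: (@box_cover_lower_bound R p d 1%R (fun=> 1%R)
  (fun k => X (B k).1) (fun k => X (B k).2) (ltW d0) ler01 (fun=> ler01)).
move=> x xd.
pose y : 'rV[R]_p := \row_i x i.
have /KB[k _ yk] : K y.
  apply: eK; split=> // i j; rewrite ord1 !mxE /ball/= sub0r normrN ger0_norm.
    by have /andP[_ /le_lt_trans->//] := xd j; rewrite /d ltr_pdivrMr// ltr_pMr// ltr1n.
  by have /andP[] := xd j.
rewrite (nneseriesD1 (P := xpredT) (n := k))//=; last first.
  by move=> i _; rewrite lee_fin mul1r prodr_ge0.
rewrite mul1r big1 => [|i _].
  by apply: leeDl; apply: nneseries_ge0 => i _ _; rewrite lee_fin mul1r prodr_ge0.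
rewrite indicE mem_set// !XE/= in_itv/=.
by have := yk i; rewrite !mxE.
Qed.

Lemma lebesgue_outer_lty K : (0 < p)%N -> compact K -> lebesgue_outer K < +oo.
Proof.
move=> p0 /compact_bounded[M [_ /(_ (Num.max M 0 + 1)%R)]].
set N := (Num.max M 0 + 1)%R => MN.
have {}MN : forall x, K x -> (`|x| <= N)%R.
  by apply: MN; rewrite /N ltr_pwDr// le_max lexx.
(* One box does the covering; boxes are open on the left, hence [- N - 1]. The remaining boxes have
   volume 0 because [0 < p]: an empty product would be 1. *)
pose B (k : nat) : 'rV[R]_p * 'rV[R]_p :=
  if k is 0%N then (const_mx (- N - 1)%R, const_mx N) else (0%R, 0%R).
apply: (@le_lt_trans _ _ (\sum_(k <oo) (box_volume (B k).1 (B k).2)%:E)).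
  apply: ereal_inf_lbound; exists B => // x /MN xN; exists 0%N => // i /=.
  rewrite !mxE; have : (`|x ord0 i| <= N)%R.
    apply: le_trans xN; rewrite /Num.norm/= mx_normrE.
    by apply: (le_bigmax _ (fun ij => `|x ij.1 ij.2|%R) (ord0, i)).
  by rewrite ler_norml => /andP[h ->]; rewrite andbT (lt_le_trans _ h)// ltrBlDr ltrDl.
rewrite (nneseriesD1 (P := xpredT) (n := 0%N))//=; last first.
  by move=> i _; rewrite lee_fin prodr_ge0// => j _; rewrite le_max lexx.
rewrite eseries0 ?adde0 ?ltry//.
move=> [|i] _ _ //=; rewrite /box_volume; case: (p) p0 => // q _.
by rewrite big_ord_recl /= !mxE subrr maxxx mul0r.
Qed.

End lebesgue_outer_body.

(** * Concave functions on a ray *)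

(* For decreasing functions upper semicontinuity is left continuity, here in
   the form [rc_left]. *)
Record ray_concave (R : realType) (a : R) (phi : R -> \bar R) : Prop := {
  rc_out : forall r, (r < a)%R -> phi r = 0;
  rc_lty : forall r, (a <= r)%R -> phi r < +oo;
  rc_left : forall r M, (a < r)%R -> phi r < M ->
    exists s, [/\ (a <= s)%R, (s < r)%R & phi s < M];
  rc_conc : forall r s t, (a <= r)%R -> (a <= s)%R -> (0 < t < 1)%R ->
    t%:E * phi r + (1 - t)%:E * phi s <= phi (t * r + (1 - t) * s)%R;
  rc_dec : forall r s, (a <= r)%R -> (r <= s)%R -> phi s <= phi r }.

Section ray_concave.
Context {R : realType}.
Implicit Types (a : R) (phi : R -> \bar R).

Lemma Phi_ray_concave phi : Phi phi <-> ray_concave 0 phi.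
Proof.
split=> [[out lty usc conc dec]|[out lty left conc dec]].
  split=> // r M r0 phirM.
  case: M phirM => [M||] phirM; last by move: phirM; rewrite ltNge leNye.
    2: by exists 0%R; split=> //; apply: lty.
  have : (- M)%:E < - phi r by rewrite EFinN lteN2.
  move=> /(usc r)[V].
  move=> /(nbhs_subspace_ex _ (ltW r0 : ray 0%R r))[W /nbhs_ballP[e/= e0 eW] VW VM].
  pose s := Num.max 0%R (r - e / 2)%R.
  have s0 : (0 <= s)%R by rewrite /s le_max lexx.
  have sr : (s < r)%R by rewrite /s gt_max r0/= ltrBlDr ltrDl divr_gt0.
  exists s; split=> //; rewrite -lteN2 -EFinN.
  apply: VM; suff : (V `&` ray 0) s by case.
  rewrite VW; split=> //; apply: eW.
  rewrite /ball/= ger0_norm ?subr_ge0 ?(ltW sr)// ltrBlDr -ltrBlDl.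
  by rewrite /s lt_max ltrD2l ltrN2 gtr_pMr// invf_lt1// ltr1n orbT.
suff usc (r x : R) : x%:E < - phi r ->
    nbhs (r : subspace (@ray R 0%R)) [set y | x%:E < - phi y].
  by split=> // r x /usc xr; exists [set y | x%:E < - phi y].
move=> xr.
have [r0|r0] := leP 0%R r; last first.
  have nr : ~ ray 0%R r by rewrite /ray/= leNgt r0.
  suff : nbhs_subspace (r : subspace (ray 0%R)) [set y | x%:E < - phi y] by [].
  by rewrite /nbhs_subspace memNset// => _ ->.
apply: (nbhs_subspace_ex _ (r0 : ray 0%R r)).2.
exists [set y : R | (0 <= y)%R -> x%:E < - phi y]; last first.
  by apply/seteqP; split => y [] //= h y0; split=> //; exact: h.
have [r1|] := ltP 0%R r; last first.
  move=> r1; apply: (@filterE _ (nbhs r)) => y y0; apply: (lt_le_trans xr).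
  by rewrite leeN2 dec// (le_trans r1).
have [|s [s0 sr xs]] := left r (- x%:E) r1; first by rewrite lteNr.
near=> y => y0; rewrite lteNr; apply: le_lt_trans xs.
by apply: dec => //; near: y; exact: lt_le_nbhsr.
Unshelve. all: by end_near. Qed.

Lemma Phi_aP a phi : Phi_ a phi <-> ray_concave a phi.
Proof.
split=> [[f /Phi_ray_concave [out lty left conc dec] <-]|[out lty left conc dec]].
  split.
  - by move=> r ra; apply: out; rewrite subr_lt0.
  - by move=> r ra; apply: lty; rewrite subr_ge0.
  - move=> r M ra /left[|s [s0 sr sM]]; first by rewrite subr_gt0.
    by exists (s + a)%R; rewrite lerDr s0 -ltrBrDr sr addrK.
  - move=> r s t ra sa t01.
    have := conc (r - a)%R (s - a)%R t; rewrite !subr_ge0 => /(_ ra sa t01).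
    by congr (_ <= f _); ring.
  - by move=> r s ra rs; apply: dec; rewrite ?subr_ge0// lerB.
exists (fun r => phi (r + a)%R); last by apply/funext => r; rewrite subrK.
apply/Phi_ray_concave; split.
- by move=> r r0; apply: out; rewrite -ltrBrDr subrr.
- by move=> r r0; apply: lty; rewrite lerDr.
- move=> r M r0 /left[|s [sa sr sM]]; first by rewrite ltrDr.
  by exists (s - a)%R; rewrite subr_ge0 sa ltrBlDr sr subrK.
- move=> r s t r0 s0 t01.
  have := conc (r + a)%R (s + a)%R t; rewrite !lerDr => /(_ r0 s0 t01).
  by congr (_ <= phi _); ring.
- by move=> r s r0 rs; apply: dec; rewrite ?lerDr// lerD2r.
Qed.

Lemma Phi_0E : Phi_ 0 = @Phi R.
Proof.
by apply/seteqP; split => phi; rewrite Phi_aP => /Phi_ray_concave.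
Qed.

Lemma ray_itv a : ray a = `[a, +oo[%classic.
Proof. by apply/seteqP; split => r /=; rewrite /ray/= in_itv/= andbT. Qed.

Lemma measurable_ray a : measurable (ray a).
Proof. by rewrite ray_itv. Qed.

(** The superlevel sets of a decreasing function on the ray are intervals. *)
Lemma measurable_ray_antitone a (f : R -> \bar R) :
  (forall r s, (a <= r)%R -> (r <= s)%R -> f s <= f r) ->
  measurable_fun (ray a) f.
Proof.
move=> dec mD; apply: (measurability _ (ErealGenOInfty.measurableE R)) => //.
move=> _ [_ [x ->] <-]; apply: is_interval_measurable => r s /=.
rewrite /ray/= !in_itv/= !andbT => -[ar xr] [as_ xs] y /andP[ry ys].
have ay := le_trans ar ry; split => //=; rewrite ?in_itv/= ?andbT.
by apply: (lt_le_trans xs); apply: dec.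
Qed.

Lemma measurable_ray_concave a phi : ray_concave a phi -> measurable_fun (ray a) phi.
Proof. by move=> rc; apply: measurable_ray_antitone; exact: (rc_dec rc). Qed.

Lemma measurable_expeR_ray_concave a phi : ray_concave a phi ->
  measurable_fun (ray a) (fun r => expeR (phi r)).
Proof.
move=> rc; apply: measurable_ray_antitone => r s ar rs.
by rewrite lee_expeR; exact: (rc_dec rc).
Qed.

End ray_concave.
#[local] Hint Extern 0 (measurable (ray _)) =>
  solve[apply: measurable_ray] : core.

(** * Integrals over a ray *)

Section weighted_integral.
Context {R : realType}.
Notation mu := (@lebesgue_measure R).
Implicit Types (a r s k : R) (g : R -> \bar R).

Lemma measurable_weight (n : nat) (D : set R) g : measurable_fun D g ->
  measurable_fun D (fun x => (x ^+ n)%:E * g x).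
Proof.
move=> mg; apply: emeasurable_funM => //.
exact/measurable_EFinP/measurable_funX.
Qed.

(** The weight can vanish at 0, so only the right half of [s, r] is kept: its length is (r - s)/2,
    and there x >= (s + r)/2 >= (r - s)/2 since s >= 0. *)
Lemma weighted_integral_ge (p : nat) a s r k g : (0 < p)%N ->
  (0 <= a)%R -> (a <= s)%R -> (s < r)%R -> (0 <= k)%R ->
  measurable_fun (ray a) g -> (forall x, ray a x -> 0 <= g x) ->
  (forall x, (s <= x <= r)%R -> k%:E <= g x) ->
  (k * ((r - s) / 2) ^+ p)%:E
    <= \int[mu]_(x in ray a) ((x ^+ p.-1)%:E * g x).
Proof.
move=> p0 a0 as_ sr k0 mg g0 kg.
pose h := ((r - s) / 2)%R; pose m := ((s + r) / 2)%R.
have h0 : (0 < h)%R by rewrite divr_gt0// subr_gt0.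
have hm : (h <= m)%R by rewrite /h /m ler_pM2r// lerBlDr -addrA; lra.
have sm : (s < m)%R by rewrite /m; lra.
have mr : (m < r)%R by rewrite /m; lra.
have sub : `[m, r]%classic `<=` ray a.
  by move=> x /=; rewrite in_itv/= => /andP[mx _]; rewrite /ray/=; lra.
have p1 x : ray a x -> (0 <= x ^+ p.-1)%R.
  by move=> ax; rewrite exprn_ge0// (le_trans a0).
apply: (@le_trans _ _ (\int[mu]_(x in `[m, r]) (k * h ^+ p.-1)%:E)).
  rewrite integral_cst//= lebesgue_measure_itv/= lte_fin mr -EFinD -EFinM lee_fin.
  rewrite -/h -mulrA (_ : r - m = h)%R; last by rewrite /m /h; lra.
  by rewrite -exprSr prednK.
apply: (@le_trans _ _ (\int[mu]_(x in `[m, r]) ((x ^+ p.-1)%:E * g x))).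
  apply: ge0_le_integral => //.
  - by move=> x _; rewrite lee_fin mulr_ge0// exprn_ge0// ltW.
  - exact: (measurable_funS (measurable_ray a) sub (measurable_weight _ mg)).
  - move=> x; rewrite /= in_itv/= => /andP[mx xr].
    have hx := le_trans hm mx.
    rewrite mulrC EFinM; apply: lee_pmul; rewrite ?lee_fin//.
    - by rewrite exprn_ge0// ltW.
    - by rewrite lerXn2r// nnegrE ?(le_trans _ hx)// ltW.
    - by apply: kg; rewrite xr andbT ltW// (lt_le_trans sm).
apply: ge0_subset_integral => //.
- exact: measurable_weight.
- by move=> x ax; rewrite mule_ge0 ?lee_fin ?p1// g0.
Qed.

End weighted_integral.

(** * Integrals under a law on the ray *)

Section ray_probability.
Context {R : realType}.
Variables (a : R) (Q : probability (measurableTypeR R) R).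
Hypothesis Qa : Q (ray a) = 1.
Implicit Types (phi : R -> \bar R).

Lemma integral_cst_ray k : \int[Q]_(r in ray a) k%:E = k%:E.
Proof. by rewrite integral_cst// -[X in _ * X]/(Q (ray a)) Qa mule1. Qed.

Lemma ray_concave_pos_lty phi : ray_concave a phi ->
  \int[Q]_(r in ray a) phi^\+ r < +oo.
Proof.
move=> rc; have [M phiM] : exists M : R, forall r, ray a r -> phi r <= M%:E.
  have := rc_lty rc (lexx a); case E : (phi a) => [x| |]// _.
    by exists x => r ar; rewrite -E; exact: (rc_dec rc).
  by exists 0%R => r ar; rewrite (le_trans (rc_dec rc (lexx a) ar))// E leNye.
apply: (@le_lt_trans _ _ (\int[Q]_(r in ray a) (Num.max M 0)%:E)).
  apply: ge0_le_integral => //.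
  - by apply: measurable_funepos; exact: measurable_ray_concave rc.
  - by move=> r ar; rewrite funeposE EFin_max ge_max !le_max phiM//= lexx orbT.
by rewrite integral_cst_ray ltry.
Qed.

Lemma ray_concave_integral_lty phi : ray_concave a phi ->
  \int[Q]_(r in ray a) phi r < +oo.
Proof.
move=> rc; rewrite integralE; apply: le_lt_trans (ray_concave_pos_lty rc).
by rewrite geeDl// oppe_le0 integral_ge0.
Qed.

Lemma ray_concave_integrable phi : ray_concave a phi ->
  -oo < \int[Q]_(r in ray a) phi r -> Q.-integrable (ray a) phi.
Proof.
move=> rc; rewrite integralE => h.
have mphi := measurable_ray_concave rc.
have pos := ray_concave_pos_lty rc.
have neg : \int[Q]_(r in ray a) phi^\- r < +oo.
  rewrite ltey; apply/eqP => E; move: h; rewrite E.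
  by move: pos; case: (\int[Q]_(_ in _) _).
apply/integrableP; split=> //.
rewrite (_ : (fun x => _) = phi^\+ \+ phi^\-); last first.
  by rewrite -fune_abse.
rewrite ge0_integralD//; first exact: lte_add_pinfty.
- exact: measurable_funepos.
- exact: measurable_funeneg.
Qed.

(** A decreasing [phi] lies below the step function equal to [m] on [a, b) and to [y] from [b] on.
    With [b = a] and [m = y] this bounds the integral by a bound of [phi a]. *)
Lemma ray_concave_integral_le phi (b m x y q : R) : ray_concave a phi ->
  (a <= b)%R -> \int[Q]_(r in ray a) phi r = x%:E ->
  phi a <= m%:E -> phi b <= y%:E -> Q (ray b) = q%:E ->
  (x <= m + (y - m) * q)%R.
Proof.
move=> rc ab phix phim phiy Qb.
have int_phi : Q.-integrable (ray a) phi.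
  by apply: ray_concave_integrable => //; rewrite phix ltNyr.
have int_cst (z : R) : Q.-integrable (ray a) (EFin \o cst z).
  by apply: finite_measure_integrable_cst.
have int_1 : Q.-integrable (ray a) (fun r => (\1_(ray b) r)%:E).
  apply: (@le_integrable _ _ _ _ _ _ _ (EFin \o cst 1%R)) => //.
    by apply/measurable_EFinP; exact: measurable_indic.
  move=> r _ /=; rewrite lee_fin indicE.
  by case: (_ \in _); rewrite ?normr0 ?normr1 ?ler01.
have int_ind : Q.-integrable (ray a) (fun r => ((y - m) * \1_(ray b) r)%:E).
  by under eq_fun do rewrite EFinM; exact: integrableZl.
rewrite -lee_fin -phix; apply: (@le_trans _ _
    (\int[Q]_(r in ray a) (m%:E + ((y - m) * \1_(ray b) r)%R%:E))).
  apply: le_integral => //; first exact: (integrableD _ (int_cst m) int_ind).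
  move=> r; rewrite inE => ar; rewrite indicE -EFinD.
  have [rb|_] := boolP (r \in ray b).
    rewrite inE in rb; rewrite mulr1 addrC subrK (le_trans _ phiy)//.
    exact: (rc_dec rc).
  by rewrite mulr0 addr0 (le_trans _ phim)//; apply: (rc_dec rc).
rewrite integralD//; first last.
- exact: int_cst.
rewrite integral_cst_ray EFinD leeD2l//.
under eq_integral do rewrite EFinM.
rewrite integralZl//.
rewrite integral_indic// setIidl; last by move=> r; exact: le_trans.
by rewrite -[X in _ * X]/(Q (ray b)) Qb.
Qed.

End ray_probability.

(** * Finiteness and coercivity of the criterion *)

Lemma expR_ge_expn (R : realType) (x : R) (n : nat) : (0 < n)%N -> (0 <= x)%R ->
  ((x / n%:R) ^+ n <= expR x)%R.
Proof.
move=> n0 x0; have nR : (n%:R != 0 :> R)%R by rewrite pnatr_eq0 -lt0n.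
rewrite -[in leRHS](divfK nR x) (mulrC _ n%:R%R) expRM_natl.
rewrite lerXn2r ?nnegrE ?divr_ge0 ?ler0n ?expR_ge0//.
by apply: le_trans (expR_ge1Dx _); rewrite lerDr.
Qed.

Section criterion.
Context {R : realType} {p : nat}.
Variables (K : set 'rV[R]_p) (c a : R) (Q : probability (measurableTypeR R) R).
Hypotheses (p0 : (0 < p)%N) (a0 : (0 <= a)%R) (Qa : Q (ray a) = 1).
Hypotheses (c0 : (0 < c)%R) (Kc : p%:R%:E * lebesgue_outer K = c%:E).
Implicit Types (phi : R -> \bar R).
Notation mu := (@lebesgue_measure R).
Notation raymass phi :=
  (\int[mu]_(r in ray a) ((r ^+ p.-1)%:E * expeR (phi r))).

Lemma raymass_ge0 phi : 0 <= raymass phi.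
Proof.
apply: integral_ge0 => r ar; rewrite mule_ge0 ?expeR_ge0// lee_fin exprn_ge0//.
exact: le_trans ar.
Qed.

(** The first integral is never [+oo] and the mass is nonnegative, so a criterion other than [-oo]
    forces both to be finite and allows computing in [R]. *)
Lemma L_fin phi : ray_concave a phi -> -oo < L K a phi Q ->
  exists x m, [/\ \int[Q]_(r in ray a) phi r = x%:E, raymass phi = m%:E,
    (0 <= m)%R & L K a phi Q = (x - c * m + 1)%:E].
Proof.
move=> rc; rewrite /L /mass Kc.
have := ray_concave_integral_lty Qa rc; have := raymass_ge0 phi.
case: (raymass phi) => [m| |]//; case: (\int[Q]_(_ in _) _) => [x| |]//.
- by move=> m0 _ _; exists x, m.
- by rewrite mulry gtr0_sg// mul1e.
Qed.

Lemma L_coercive (b q B : R) : (a < b)%R -> (0 < q)%R -> Q (ray b) = q%:E ->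
  exists M : R, forall phi, ray_concave a phi -> B%:E <= L K a phi Q ->
    phi a <= M%:E /\ (- M)%:E <= phi b.
Proof.
move=> ab q0 Qb.
have q1 : (q <= 1)%R by rewrite -lee_fin -Qb; exact: probability_le1.
pose k := ((b - a) * q / 4)%R.
have k0 : (0 < k)%R by rewrite divr_gt0// mulr_gt0// subr_gt0.
pose A := (c * expR (-1) * k ^+ p)%R.
have A0 : (0 < A)%R by rewrite !mulr_gt0 ?expR_gt0 ?exprn_gt0.
pose N : R := (p.+2)%:R.
(* For [m > M0]: the bound [1 - B] gives [m + 1 - B <= 2 * m], and the last bound makes
   [A * (m / N) ^+ p.+2], which is at most [A * expR m], exceed [2 * m ^+ p.+1]. *)
pose M0 := (Num.max (Num.max 1 (1 - B)) (2 * N ^+ p.+2 / A))%R.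
have M01 : (1 <= M0)%R by rewrite /M0 !le_max lexx.
(* The second term bounds [- phi b]: writing m and y for [phi a] and [phi b], one has B - 1 <= m (1
   - q) + y q with m <= M0. *)
exists (Num.max M0 ((M0 + 1 - B) / q))%R => phi rc BL.
have [x [m' [phix phim' m'0 LE]]] := L_fin rc (lt_le_trans (ltNyr _) BL).
move: BL; rewrite LE lee_fin => BL.
have cm0 : (0 <= c * m')%R by rewrite mulr_ge0// ltW.
have phib : -oo < phi b.
  rewrite ltNye; apply/eqP => phibNy.
  have [m phim] : exists m : R, phi a <= m%:E.
    have := rc_lty rc (lexx a); case: (phi a) => [m| |]// _; first by exists m.
    by exists 0%R; rewrite leNye.
  (* When [phi b = -oo] the step bound holds for every [y]; this choice turns it into
     [x <= x - 1]. *)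
  have := @ray_concave_integral_le _ _ _ Qa phi b m x (m + (x - m - 1) / q)%R q
    rc (ltW ab) phix phim.
  rewrite phibNy leNye => /(_ isT Qb).
  have -> : (m + (x - m - 1) / q - m = (x - m - 1) / q)%R by ring.
  by rewrite divfK ?gt_eqF//; lra.
have := rc_dec rc (lexx a) (ltW ab); have := rc_lty rc (lexx a).
case phiaE : (phi a) => [m| |]//; last by rewrite leeNy_eq gt_eqF.
move=> _; case phibE : (phi b) phib => [y| |]// _; rewrite lee_fin => ym.
have xle : (x <= m + (y - m) * q)%R.
  by apply: (ray_concave_integral_le Qa rc (ltW ab) phix _ _ Qb);
    rewrite ?phiaE ?phibE.
have ymq : ((y - m) * q <= 0)%R by rewrite mulr_le0_ge0 ?subr_le0// ltW.
suff mM : (m <= M0)%R.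
  split; first by rewrite lee_fin le_max mM.
  rewrite lee_fin lerNl le_max; apply/orP; right.
  rewrite ler_pdivlMr//; nra.
rewrite leNgt; apply/negP; rewrite /M0 !gt_max -andbA => /and3P[m1 mB mA].
have m0 : (0 < m)%R by lra.
(* The criterion bounds (m - y) q by 2 m, so with this weight concavity loses at most 1 between [a]
   and [a + h]. Half the length [h] is [k / m], the origin of [k]. *)
pose t := (q / (2 * m))%R; pose h := (t * (b - a))%R.
have t0 : (0 < t)%R by rewrite divr_gt0// mulr_gt0.
have t1 : (t < 1)%R by rewrite ltr_pdivrMr ?mulr_gt0//; nra.
have h0 : (0 < h)%R by rewrite mulr_gt0// subr_gt0.
have tm : (t * (m - y) <= 1)%R.
  by rewrite /t mulrAC ler_pdivrMr ?mulr_gt0//; nra.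
have phih : (m - 1)%:E <= phi (a + h)%R.
  have := rc_conc rc (ltW ab) (lexx a); rewrite phiaE phibE.
  have -> : (a + h = t * b + (1 - t) * a)%R by rewrite /h; ring.
  move=> /(_ t); rewrite t0 t1 => /(_ isT); apply: le_trans.
  by rewrite -!EFinM -EFinD lee_fin; lra.
have : ((expR (m - 1)) * ((a + h - a) / 2) ^+ p)%:E <= raymass phi.
  apply: weighted_integral_ge => //; rewrite ?ltrDl ?expR_ge0//.
  - exact: measurable_expeR_ray_concave.
  - by move=> r _; rewrite expeR_ge0.
  - move=> r /andP[ar rh]; rewrite -[(expR _)%:E]/(expeR (m - 1)%:E) lee_expeR.
    by apply: (le_trans phih); exact: (rc_dec rc).
rewrite phim' lee_fin addrAC subrr add0r.
have -> : (h / 2 = k / m)%R by rewrite /h /t /k; field; rewrite gt_eqF.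
rewrite expRD expr_div_n => mass_ge.
have : (A * expR m <= 2 * m ^+ p.+1)%R.
  have : (c * (expR m * expR (-1) * (k ^+ p / m ^+ p)) <= 2 * m)%R.
    by apply: (@le_trans _ _ (c * m')%R); [rewrite ler_pM2l|lra].
  rewrite -(@ler_pM2r _ (m ^+ p)) ?exprn_gt0//.
  congr (_ <= _)%R; last by rewrite exprS mulrA.
  by rewrite /A; field; rewrite expf_neq0// gt_eqF.
apply/negP; rewrite -ltNge.
have N0 : (0 < N)%R by rewrite ltr0n.
apply: (@lt_le_trans _ _ (A * (m / N) ^+ p.+2)%R); last first.
  by rewrite ler_pM2l// expR_ge_expn// ltW.
rewrite expr_div_n mulrA ltr_pdivlMr ?exprn_gt0//.
rewrite (exprS m p.+1) mulrA mulrAC ltr_pM2r ?exprn_gt0//.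
by move: mA; rewrite ltr_pdivrMr// (mulrC A).
Qed.

(** Otherwise (a, oo), a countable union of closed rays, would be null and all the mass would sit at
    [a]. *)
Lemma exists_tail_mass : Q [set a] < 1 ->
  exists b q : R, [/\ (a < b)%R, (0 < q)%R & Q (ray b) = q%:E].
Proof.
move=> Q1; apply: contrapT => H.
have Q0 b : (a < b)%R -> Q (ray b) = 0.
  move=> ab; apply/eqP; rewrite eq_le measure_ge0 andbT leNgt; apply/negP => Qb.
  apply: H; exists b, (fine (Q (ray b))).
  have fQ : Q (ray b) \is a fin_num by exact: fin_num_measure.
  by split => //; rewrite ?fineK// -lte_fin fineK.
move: Q1; apply/negP; rewrite -leNgt -Qa.
pose F (n : nat) : set R := ray (a + n.+1%:R^-1)%R.
have F0 : Q (\bigcup_n F n) = 0.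
  have : Q.-negligible (\bigcup_n F n).
    apply: negligible_bigcup => n; apply/negligibleP; first exact: measurable_ray.
    by apply: Q0; rewrite ltrDl.
  by move/negligibleP; apply; apply: bigcupT_measurable => n; exact: measurable_ray.
apply: (@le_trans _ _ (Q ([set a] `|` \bigcup_n F n))).
  apply: le_measure; rewrite ?inE//.
  - apply: measurableU => //; apply: bigcupT_measurable => n; exact: measurable_ray.
  move=> r; rewrite /ray/= le_eqVlt => /predU1P[->|ar]; first by left.
  by right; have [n anr] := ltr_add_invr ar; exists n => //; exact: ltW.
apply: (@le_trans _ _ (Q [set a] + Q (\bigcup_n F n))).
  apply: measureU2 => //; apply: bigcupT_measurable => n; exact: measurable_ray.
by rewrite F0 adde0.
Qed.

End criterion.

(** * Midpoints and near-maximizers *)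

(** Real minorants of [A] and [B] avoid arithmetic with [-oo]: if [A] or [B] is [-oo], the left-hand
    side is [-oo] and there is no minorant. *)
Lemma ereal_convP (R : realType) (A B C : \bar R) (t : R) : (0 < t < 1)%R ->
  A < +oo -> B < +oo ->
  t%:E * A + (1 - t)%:E * B <= C <->
  (forall x y, x%:E <= A -> y%:E <= B -> (t * x + (1 - t) * y)%:E <= C).
Proof.
move=> /andP[t0 t1]; have t'0 : (0 < 1 - t)%R by rewrite subr_gt0.
move: A B => [A| |] [B| |]//= _ _; split => [+ x y|H].
- rewrite -!EFinM -EFinD !lee_fin => ABC xA yB; apply: le_trans ABC.
  by rewrite lee_fin lerD// ler_pM2l.
- by rewrite -!EFinM -EFinD; apply: H.
- by rewrite !leeNy_eq.
- by rewrite gt0_muleNy ?lte_fin// addeNy leNye.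
- by rewrite !leeNy_eq.
- by rewrite gt0_muleNy ?lte_fin// addNye leNye.
- by rewrite !leeNy_eq.
- by rewrite gt0_muleNy ?lte_fin// addNye leNye.
Qed.

Section midpoint.
Context {R : realType}.
Implicit Types (a : R) (phi : R -> \bar R).

Definition midpoint phi1 phi2 : R -> \bar R :=
  fun r => 2^-1%:E * (phi1 r + phi2 r).

Definition exp_half phi : R -> R := fun r => fine (expeR (2^-1%:E * phi r)).

(* With [w_i = exp (phi_i / 2)], the exponential of the midpoint is [w1 * w2],
   whence [exp phi1 + exp phi2 = 2 * exp midpoint + (w1 - w2) ^ 2]. *)
Lemma exp_halfE phi r : phi r < +oo -> (exp_half phi r ^+ 2)%:E = expeR (phi r).
Proof.
rewrite /exp_half; case: (phi r) => [x| |]//= _.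
  by rewrite expr2 -expRD -mulrDr -mulr2n; congr (expR _)%:E; field.
by rewrite gt0_muleNy ?lte_fin ?invr_gt0//= expr0n.
Qed.

Lemma exp_half_midpoint phi1 phi2 r : phi1 r < +oo -> phi2 r < +oo ->
  expeR (midpoint phi1 phi2 r) = (exp_half phi1 r * exp_half phi2 r)%:E.
Proof.
rewrite /exp_half /midpoint.
case: (phi1 r) => [x| |]//; case: (phi2 r) => [y| |]//= _ _.
- by rewrite -expRD mulrDr.
- by rewrite gt0_muleNy ?lte_fin ?invr_gt0//= mulr0.
- by rewrite gt0_muleNy ?lte_fin ?invr_gt0//= mul0r.
- by rewrite gt0_muleNy ?lte_fin ?invr_gt0//= mul0r.
Qed.

Lemma exp_half_le phi1 phi2 r s : phi2 s < +oo -> phi1 r <= phi2 s ->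
  (exp_half phi1 r <= exp_half phi2 s)%R.
Proof.
rewrite /exp_half; case: (phi2 s) => [x| |]//; case: (phi1 r) => [y| |]//= _.
- by rewrite lee_fin => h; rewrite ler_expR ler_pM2l ?invr_gt0.
- by rewrite gt0_muleNy ?lte_fin ?invr_gt0//= expR_ge0.
Qed.

Lemma measurable_exp_half a phi : ray_concave a phi ->
  measurable_fun (ray a) (exp_half phi).
Proof.
move=> rc; apply/measurable_EFinP; apply: measurable_ray_antitone => r s ar rs.
rewrite /= lee_fin; apply: exp_half_le; first exact: (rc_lty rc).
exact: (rc_dec rc).
Qed.

Lemma ray_concave_midpoint a phi1 phi2 : ray_concave a phi1 ->
  ray_concave a phi2 -> ray_concave a (midpoint phi1 phi2).
Proof.
move=> rc1 rc2.
have half0 : 0 < (2^-1 : R)%:E by rewrite lte_fin invr_gt0.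
have lty r : (a <= r)%R -> midpoint phi1 phi2 r < +oo.
  move=> ar; rewrite /midpoint.
  have := rc_lty rc1 ar; have := rc_lty rc2 ar.
  case: (phi1 r) => [x| |]//; case: (phi2 r) => [y| |]//= _ _;
    by rewrite ?gt0_muleNy// -?EFinM ?ltry.
have dec r s : (a <= r)%R -> (r <= s)%R ->
    midpoint phi1 phi2 s <= midpoint phi1 phi2 r.
  move=> ar rs; rewrite /midpoint lee_pmul2l//.
  by apply: leeD; [exact: (rc_dec rc1)|exact: (rc_dec rc2)].
split => //.
- by move=> r ra; rewrite /midpoint (rc_out rc1)// (rc_out rc2)// adde0 mule0.
- move=> r M ar; case: M => [M| |]; last 2 first.
  + by exists a; split => //; apply: lty.
  + by rewrite ltNge leNye.
  rewrite /midpoint => rM.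
  (* [2 * M] is split into one strict bound per function. Left continuity gives a point for each,
     and the larger point serves both because the functions decrease. *)
  have [u [v [ru rv uv]]] : exists u v : R,
      [/\ phi1 r < u%:E, phi2 r < v%:E & (u + v = 2 * M)%R].
    have := rc_lty rc1 (ltW ar); have := rc_lty rc2 (ltW ar); move: rM.
    case: (phi1 r) => [x| |]//; case: (phi2 r) => [y| |]//=.
    + rewrite -EFinM !lte_fin => xyM _ _.
      pose d := (M - 2^-1 * (x + y))%R.
      exists (x + d)%R, (y + d)%R; rewrite !lte_fin !ltrDl subr_gt0; split=> //.
      by rewrite /d; field.
    + by move=> _ _ _; exists (x + 1)%R, (2 * M - (x + 1))%R;
        rewrite lte_fin ltrDl ltNyr addrC subrK.
    + by move=> _ _ _; exists (2 * M - (y + 1))%R, (y + 1)%R;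
        rewrite lte_fin ltrDl ltNyr subrK.
    + by move=> _ _ _; exists M, M; rewrite ltNyr mulr_natl.
  have [s1 [as1 s1r s1u]] := rc_left rc1 ar ru.
  have [s2 [as2 s2r s2v]] := rc_left rc2 ar rv.
  exists (Num.max s1 s2); rewrite le_max as1 gt_max s1r s2r; split => //.
  have h1 : phi1 (Num.max s1 s2) < u%:E.
    by apply: le_lt_trans s1u; apply: (rc_dec rc1); rewrite // le_max lexx.
  have h2 : phi2 (Num.max s1 s2) < v%:E.
    by apply: le_lt_trans s2v; apply: (rc_dec rc2); rewrite // le_max lexx orbT.
  have -> : M%:E = (2^-1)%:E * (u%:E + v%:E).
    by rewrite -EFinD uv -EFinM; congr _%:E; field.
  by rewrite lte_pmul2l//; apply: lteD.
- move=> r s t ar as_ t01; apply/ereal_convP => //; [exact: lty..|].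
  set z := (t * r + (1 - t) * s)%R => x y.
  have := (ereal_convP _ t01 (rc_lty rc1 ar) (rc_lty rc1 as_)).1 (rc_conc rc1 ar as_ t01).
  have := (ereal_convP _ t01 (rc_lty rc2 ar) (rc_lty rc2 as_)).1 (rc_conc rc2 ar as_ t01).
  rewrite -/z /midpoint.
  have := rc_lty rc1 ar; have := rc_lty rc2 ar.
  have := rc_lty rc1 as_; have := rc_lty rc2 as_.
  case: (phi1 r) => [x1| |]//; case: (phi2 r) => [x2| |]//=;
    rewrite ?addeNy ?addNye ?gt0_muleNy//.
  case: (phi1 s) => [y1| |]//; case: (phi2 s) => [y2| |]//=;
    rewrite ?addeNy ?addNye ?gt0_muleNy//.
  move=> _ _ _ _ /(_ x2 y2 (lexx _) (lexx _)) c2 /(_ x1 y1 (lexx _) (lexx _)) c1.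
  rewrite -!EFinM !lee_fin => hx hy.
  apply: (@le_trans _ _ (2^-1%:E *
      ((t * x1 + (1 - t) * y1)%:E + (t * x2 + (1 - t) * y2)%:E))).
    rewrite -EFinD -EFinM lee_fin.
    have /andP[t0 t1] := t01; have t'0 : (0 <= 1 - t)%R by rewrite subr_ge0 ltW.
    have := lerD (ler_wpM2l (ltW t0) hx) (ler_wpM2l t'0 hy).
    by move/le_trans; apply; rewrite le_eqVlt; apply/orP; left; apply/eqP; ring.
  by rewrite lee_pmul2l//; apply: leeD.
Qed.

End midpoint.

(** * Strong concavity of the criterion *)

Section near_maximizers.
Context {R : realType} {p : nat}.
Variables (K : set 'rV[R]_p) (c a : R) (Q : probability (measurableTypeR R) R).
Hypotheses (p0 : (0 < p)%N) (a0 : (0 <= a)%R) (Qa : Q (ray a) = 1).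
Hypotheses (c0 : (0 < c)%R) (Kc : p%:R%:E * lebesgue_outer K = c%:E).
Implicit Types (phi : R -> \bar R).
Notation mu := (@lebesgue_measure R).
Notation raymass phi :=
  (\int[mu]_(r in ray a) ((r ^+ p.-1)%:E * expeR (phi r))).
Notation dist2 phi1 phi2 := (\int[mu]_(r in ray a)
  ((r ^+ p.-1)%:E * ((exp_half phi1 r - exp_half phi2 r) ^+ 2)%:E)).

Lemma weight_ge0 r : ray a r -> 0 <= ((r ^+ p.-1)%:E : \bar R).
Proof. by move=> ar; rewrite lee_fin exprn_ge0// (le_trans a0). Qed.

Lemma measurable_exp_half_dist phi1 phi2 : ray_concave a phi1 ->
  ray_concave a phi2 -> measurable_fun (ray a)
    (fun r => ((exp_half phi1 r - exp_half phi2 r) ^+ 2)%:E).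
Proof.
by move=> rc1 rc2; apply/measurable_EFinP/measurable_funX/measurable_funB;
  exact: measurable_exp_half.
Qed.

(** All integrands are nonnegative, so the pointwise identity integrates without any finiteness
    assumption. *)
Lemma raymass_parallelogram phi1 phi2 : ray_concave a phi1 ->
  ray_concave a phi2 -> raymass phi1 + raymass phi2 =
    2%:E * raymass (midpoint phi1 phi2) + dist2 phi1 phi2.
Proof.
move=> rc1 rc2; have rcm := ray_concave_midpoint rc1 rc2.
have m1 := measurable_expeR_ray_concave rc1.
have m2 := measurable_expeR_ray_concave rc2.
have mm := measurable_expeR_ray_concave rcm.
have md := measurable_exp_half_dist rc1 rc2.
rewrite -ge0_integralD//; first last.
- exact: measurable_weight.
- by move=> r ar; rewrite mule_ge0 ?expeR_ge0// weight_ge0.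
- exact: measurable_weight.
- by move=> r ar; rewrite mule_ge0 ?expeR_ge0// weight_ge0.
rewrite -ge0_integralZl//; first last.
- by move=> r ar; rewrite mule_ge0 ?expeR_ge0// weight_ge0.
- exact: measurable_weight.
rewrite -ge0_integralD//; first last.
- exact: measurable_weight.
- by move=> r ar; rewrite mule_ge0 ?weight_ge0// lee_fin sqr_ge0.
- by apply: emeasurable_funM => //; exact: measurable_weight.
- by move=> r ar; rewrite !mule_ge0 ?expeR_ge0// weight_ge0.
apply: eq_integral => r; rewrite inE => ar.
have l1 := rc_lty rc1 ar; have l2 := rc_lty rc2 ar.
rewrite -(exp_halfE l1) -(exp_halfE l2) exp_half_midpoint//.
by rewrite -!EFinM -!EFinD; congr _%:E; ring.
Qed.

(** The first term is linear in [phi], so the criterion at the midpoint is the mean of the two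
    criteria plus [c / 2] times the squared distance, and it is at most [S]. *)
Lemma L_parallelogram phi1 phi2 (S e : R) :
  ray_concave a phi1 -> ray_concave a phi2 ->
  (forall phi, ray_concave a phi -> L K a phi Q <= S%:E) ->
  (S - e)%:E <= L K a phi1 Q -> (S - e)%:E <= L K a phi2 Q ->
  c%:E * dist2 phi1 phi2 <= (2 * e)%:E.
Proof.
move=> rc1 rc2 LS L1 L2; have rcm := ray_concave_midpoint rc1 rc2.
have [x1 [m1 [E1 I1 m10 LE1]]] := L_fin a0 Qa c0 Kc rc1 (lt_le_trans (ltNyr _) L1).
have [x2 [m2 [E2 I2 m20 LE2]]] := L_fin a0 Qa c0 Kc rc2 (lt_le_trans (ltNyr _) L2).
move: L1 L2; rewrite LE1 LE2 !lee_fin => L1 L2.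
have Em : \int[Q]_(r in ray a) midpoint phi1 phi2 r = (2^-1 * (x1 + x2))%:E.
  have i1 : Q.-integrable (ray a) phi1.
    by apply: ray_concave_integrable => //; rewrite E1 ltNyr.
  have i2 : Q.-integrable (ray a) phi2.
    by apply: ray_concave_integrable => //; rewrite E2 ltNyr.
  rewrite /midpoint integralZl//; last exact: integrableD.
  by rewrite integralD// EFinM EFinD E1 E2.
have := raymass_parallelogram rc1 rc2; rewrite I1 I2.
have := LS _ rcm; rewrite /L /mass Kc Em.
have := raymass_ge0 (p := p) a0 (midpoint phi1 phi2).
have : 0 <= dist2 phi1 phi2.
  by apply: integral_ge0 => r ar; rewrite mule_ge0 ?weight_ge0// lee_fin sqr_ge0.
case: (dist2 phi1 phi2) => [d| |]//; case: (raymass _) => [v| |]//.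
- move=> _ _; rewrite -!EFinM -EFinB -!EFinD !lee_fin => LSv /(congr1 fine)/= vd.
  have := congr1 ( *%R c) vd; lra.
- by move=> _ _ _; rewrite mulry gtr0_sg// mul1e.
- by move=> _ _ _; rewrite mulry gtr0_sg// mul1e.
Qed.

(* As both functions decrease, [exp_half phi1 - exp_half phi2] is bounded below
   on all of [[s, r]] by its value with [phi1] taken at [r] and [phi2] at [s]. *)
Lemma near_maximizers_gap phi1 phi2 (S e s r u v : R) :
  ray_concave a phi1 -> ray_concave a phi2 ->
  (forall phi, ray_concave a phi -> L K a phi Q <= S%:E) ->
  (S - e)%:E <= L K a phi1 Q -> (S - e)%:E <= L K a phi2 Q ->
  (a <= s)%R -> (s < r)%R -> (u <= v)%R ->
  phi2 s <= u%:E -> v%:E <= phi1 r ->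
  (c * ((expR (v / 2) - expR (u / 2)) ^+ 2 * ((r - s) / 2) ^+ p) <= 2 * e)%R.
Proof.
move=> rc1 rc2 LS L1 L2 as_ sr uv phi2u phi1v.
rewrite -lee_fin; apply: le_trans (L_parallelogram rc1 rc2 LS L1 L2).
rewrite EFinM; apply: lee_wpmul2l; first by rewrite lee_fin ltW.
apply: weighted_integral_ge => //.
- exact: sqr_ge0.
- exact: measurable_exp_half_dist.
- by move=> x _; rewrite lee_fin sqr_ge0.
move=> x /andP[sx xr]; have ax := le_trans as_ sx.
have hv : (expR (v / 2) <= exp_half phi1 x)%R.
  rewrite -[leLHS]/(fine (expeR (v / 2)%:E)) mulrC EFinM.
  apply: (@exp_half_le _ (fun=> v%:E) _ 0%R); first exact: rc_lty rc1 _ _.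
  by apply: (le_trans phi1v); apply: (rc_dec rc1).
have hu : (exp_half phi2 x <= expR (u / 2))%R.
  rewrite -[leRHS]/(fine (expeR (u / 2)%:E)) mulrC EFinM.
  apply: (@exp_half_le _ _ (fun=> u%:E) _ 0%R); first by rewrite ltry.
  by apply: le_trans phi2u; apply: (rc_dec rc2).
have uv' : (expR (u / 2) <= expR (v / 2))%R by rewrite ler_expR ler_pM2r ?invr_gt0.
rewrite lee_fin lerXn2r ?nnegrE ?subr_ge0 ?lerB//.
exact: le_trans hu (le_trans uv' hv).
Qed.

End near_maximizers.

(** * Limits of concave functions *)

Section ereal_limits.
Context {R : realType}.
Implicit Types (u : (\bar R)^nat) (A B x : \bar R).

Lemma ereal_dense A B : A < B -> exists x : R, A < x%:E /\ x%:E < B.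
Proof.
move: A B => [A| |] [B| |]//; rewrite ?lte_fin => AB.
- by exists ((A + B) / 2)%R; rewrite !lte_fin !(midf_lt AB).
- by exists (A + 1)%R; rewrite lte_fin ltrDl ltry.
- by exists (B - 1)%R; rewrite lte_fin ltrBlDr ltrDl ltNyr.
- by exists 0%R; rewrite ltNyr ltry.
Qed.

Lemma ereal_le_of_lt A B : (forall x : R, x%:E < A -> x%:E <= B) -> A <= B.
Proof.
move=> H; rewrite leNgt; apply/negP => /ereal_dense[x [Bx xA]].
by have := H x xA; rewrite leNgt Bx.
Qed.

Lemma limn_einfE u : limn_einf u = ereal_sup (range (einfs u)).
Proof. by rewrite limn_einf_lim; apply/cvg_lim => //; exact: cvg_einfs_sup. Qed.

Lemma limn_esupE u : limn_esup u = ereal_inf (range (esups u)).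
Proof. by rewrite limn_esup_lim; apply/cvg_lim => //; exact: cvg_esups_inf. Qed.

Lemma limn_einf_lt u x : limn_einf u < x ->
  forall N, exists2 n, (N <= n)%N & u n < x.
Proof.
rewrite limn_einfE => ux N.
have : einfs u N < x by apply: le_lt_trans ux; apply: ereal_sup_ubound; exists N.
by move=> /ereal_inf_lt[_ [n /= Nn <-]] unx; exists n.
Qed.

Lemma lt_limn_einf u x : x < limn_einf u ->
  exists N, forall n, (N <= n)%N -> x < u n.
Proof.
rewrite limn_einfE => /ereal_sup_gt[_ [N _ <-]] xN; exists N => n Nn.
by apply: (lt_le_trans xN); apply: ereal_inf_lbound; exists n.
Qed.

Lemma le_limn_einf u x N : (forall n, (N <= n)%N -> x <= u n) -> x <= limn_einf u.
Proof.
move=> xu; rewrite limn_einfE; apply: (@le_trans _ _ (einfs u N)).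
  by apply: le_ereal_inf_tmp => _ [n /= Nn <-]; exact: xu.
by apply: ereal_sup_ubound; exists N.
Qed.

Lemma lt_limn_esup u x : x < limn_esup u ->
  forall N, exists2 n, (N <= n)%N & x < u n.
Proof.
rewrite limn_esupE => ux N.
have : x < esups u N by apply: (lt_le_trans ux); apply: ereal_inf_lbound; exists N.
by move=> /ereal_sup_gt[_ [n /= Nn <-]] unx; exists n.
Qed.

Lemma limn_esup_lt u x : limn_esup u < x ->
  exists N, forall n, (N <= n)%N -> u n < x.
Proof.
rewrite limn_esupE => /ereal_inf_lt[_ [N _ <-]] xN; exists N => n Nn.
by apply: le_lt_trans xN; apply: ereal_sup_ubound; exists n.
Qed.

Lemma limn_esup_le u x N : (forall n, (N <= n)%N -> u n <= x) -> limn_esup u <= x.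
Proof.
move=> xu; rewrite limn_esupE; apply: (@le_trans _ _ (esups u N)).
  by apply: ereal_inf_lbound; exists N.
by apply: ge_ereal_sup => _ [n /= Nn <-]; exact: xu.
Qed.

(** A level x >= 0 is itself the exponential of some extended real, at which the eventual lower
    bound of [u] is read off. *)
Lemma expeR_limn_einf u : expeR (limn_einf u) <= limn_einf (fun n => expeR (u n)).
Proof.
apply: ereal_le_of_lt => x xu; have [x0|x0] := ltP x 0%R.
  apply: (@le_limn_einf _ _ 0%N) => n _.
  by rewrite (le_trans _ (expeR_ge0 _))// lee_fin ltW.
have [z zE] := expeR_total (x0 : 0 <= x%:E).
move: xu; rewrite -zE lte_expeR => /lt_limn_einf[N zu].
by apply: (@le_limn_einf _ _ N) => n /zu ?; rewrite lee_expeR ltW.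
Qed.

End ereal_limits.

(** An explicit weight replaces the limit t -> 0 in t z + (1 - t) x -> x > w; [D] is positive and
    bounds x - z. *)
Lemma small_weight (R : realFieldType) (w x z t1 : R) : (w < x)%R -> (0 < t1)%R ->
  exists t, [/\ (0 < t)%R, (t <= t1)%R & (w <= t * z + (1 - t) * x)%R].
Proof.
move=> wx t10.
pose D := (`|x| + `|z| + (x - w))%R.
have xw0 : (0 < x - w)%R by rewrite subr_gt0.
have D0 : (0 < D)%R by rewrite ltr_wpDl// addr_ge0.
pose t2 := ((x - w) / D)%R.
have t20 : (0 < t2)%R by rewrite divr_gt0.
have t2D : (t2 * D = x - w)%R by rewrite divfK// gt_eqF.
pose t := Num.min t1 t2.
have t0 : (0 < t)%R by rewrite /t lt_min t10.
exists t; split=> //; first by rewrite /t ge_min lexx.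
have := ler_norm x; have := ler_norm (- z)%R; rewrite normrN => nz nx.
have : (t * (x - z) <= t2 * D)%R.
  apply: (@le_trans _ _ (t * D)%R); first by rewrite ler_pM2l// /D; lra.
  by rewrite ler_pM2r// /t ge_min lexx orbT.
by rewrite t2D; lra.
Qed.

(** Puts [r] between [s], with a small weight, and a point strictly to its left, written as in the
    infimum defining [limit_hull]. The bound [t1] keeps t (s - a) below (r - a)/2, so that [l] is
    nonnegative. *)
Lemma convex_split (R : realFieldType) (a r s x w z : R) :
  (a < r)%R -> (r < s)%R -> (w < x)%R -> exists t l,
  [/\ (0 < t < 1)%R, (0 <= l < 1)%R,
      r = (t * s + (1 - t) * (a + l * (r - a)))%R
    & (w <= t * z + (1 - t) * x)%R].
Proof.
move=> ar rs wx.
have sa0 : (0 < s - a)%R by lra.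
pose t1 := ((r - a) / (2 * (s - a)))%R.
have t10 : (0 < t1)%R by rewrite divr_gt0 ?subr_gt0// mulr_gt0.
have t1D : (t1 * (s - a) = (r - a) / 2)%R by rewrite /t1; field; rewrite gt_eqF.
have t11 : (t1 < 1)%R by rewrite -(@ltr_pM2r _ (s - a)%R) ?t1D; lra.
have [t [t0 tt1 wt]] := small_weight z wx t10.
have t'0 : (0 < 1 - t)%R by lra.
have tr : (t * (s - a) <= (r - a) / 2)%R by rewrite -t1D ler_pM2r.
exists t, ((r - a - t * (s - a)) / ((1 - t) * (r - a)))%R; split=> //.
- by lra.
- apply/andP; split; first by rewrite divr_ge0 ?mulr_ge0; lra.
  by rewrite ltr_pdivrMr ?mulr_gt0 ?subr_gt0//; nra.
- by field; apply/andP; split; rewrite gt_eqF//; lra.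
Qed.

Lemma limn_einf_pZl (R : realType) (u : (\bar R)^nat) (k : R) : (0 <= k)%R ->
  (forall n, 0 <= u n) -> k%:E * limn_einf u <= limn_einf (fun n => k%:E * u n).
Proof.
rewrite le_eqVlt => /predU1P[<-|k0] u0.
  by rewrite mul0e; apply: (@le_limn_einf _ _ _ 0%N) => n _; rewrite mul0e.
apply: ereal_le_of_lt => x xu.
have /lt_limn_einf[N HN] : k^-1%:E * x%:E < limn_einf u by rewrite lte_pdivrMl.
by apply: (@le_limn_einf _ _ _ N) => n /HN/ltW; rewrite lee_pdivrMl.
Qed.

(** * Limit of a bounded sequence with an eventual gap property *)

Section ray_concave_limit.
Context {R : realType}.
Variables (a b M : R) (phi_ : (R -> \bar R)^nat).
Hypotheses (ab : (a < b)%R) (rc : forall n, ray_concave a (phi_ n)).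
Hypotheses (phia : forall n, phi_ n a <= M%:E) (phib : forall n, (- M)%:E <= phi_ n b).
Hypothesis gap : forall s r u v : R, (a <= s)%R -> (s < r)%R -> (u < v)%R ->
  exists N, forall n m, (N <= n)%N -> (N <= m)%N ->
    phi_ m s <= u%:E -> v%:E <= phi_ n r -> False.

Let psi r := limn_einf (phi_ ^~ r).
Let Psi r := limn_esup (phi_ ^~ r).

(** Two levels u < v would fit in between. The gap property excludes independent indices [m] and
    [n], so liminf and limsup may be approached along different subsequences. *)
Let Psi_le_psi s r : (a <= s)%R -> (s < r)%R -> Psi r <= psi s.
Proof.
move=> as_ sr; rewrite leNgt; apply/negP => /ereal_dense[u [su ur]].
have [v [uv vr]] := ereal_dense ur; rewrite lte_fin in uv.
have [N HN] := gap as_ sr uv.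
have [m Nm /ltW mu] := limn_einf_lt su N.
have [n Nn /ltW vn] := lt_limn_esup vr N.
exact: HN Nn Nm mu vn.
Qed.

(** No point lies to the left of [a], so the value at [a] is carried to the right: if
    [phi_ n a > v], concavity and [phi_ n b >= - M] give [phi_ n >= u] at a fixed point just after
    [a], where limsup is at most [psi a < u]. *)
Let Psi_le_psi_a : Psi a <= psi a.
Proof.
rewrite leNgt; apply/negP => /ereal_dense[u [au ua]].
have [v [uv va]] := ereal_dense ua; rewrite lte_fin in uv.
have half0 : (0 < 2^-1 :> R)%R by rewrite invr_gt0.
have [t [t0 t12 ut]] := small_weight (- M) uv half0.
have t01 : (0 < t < 1)%R by rewrite t0 (le_lt_trans t12)// invf_lt1// ltr1n.
have ar : (a < t * b + (1 - t) * a)%R.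
  have -> : (t * b + (1 - t) * a = a + t * (b - a))%R by ring.
  by rewrite ltrDl mulr_gt0// subr_gt0.
have := le_lt_trans (Psi_le_psi (lexx a) ar) au.
move=> /limn_esup_lt[N HN]; have [n /HN + vn] := lt_limn_esup va N.
apply/negP; rewrite -leNgt.
have lb := rc_lty (rc n) (ltW ab); have la := rc_lty (rc n) (lexx a).
have /(ereal_convP _ t01 lb la) := rc_conc (rc n) (ltW ab) (lexx a) t01.
move=> /(_ _ _ (phib n) (ltW vn)); apply: le_trans.
by rewrite lee_fin.
Qed.

Let psi_le_Psi r : psi r <= Psi r. Proof. exact: limn_einf_sup. Qed.

Let psi_le r : (a <= r)%R -> psi r <= M%:E.
Proof.
move=> ar; apply: (le_trans (psi_le_Psi r)); apply: (@limn_esup_le _ _ _ 0%N) => n _.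
by apply: le_trans (phia n); apply: (rc_dec (rc n)).
Qed.

Let psi_dec r s : (a <= r)%R -> (r <= s)%R -> psi s <= psi r.
Proof.
move=> ar rs; apply: ereal_le_of_lt => x /lt_limn_einf[N xN].
apply: (@le_limn_einf _ _ _ N) => n /xN/ltW xs; apply: (le_trans xs).
exact: (rc_dec (rc n)).
Qed.

Let psi_conc r s t x y : (a <= r)%R -> (a <= s)%R -> (0 < t < 1)%R ->
  x%:E <= psi r -> y%:E <= psi s ->
  (t * x + (1 - t) * y)%:E <= psi (t * r + (1 - t) * s)%R.
Proof.
move=> ar as_ t01 xr ys; apply: ereal_le_of_lt => w; rewrite lte_fin => wxy.
pose d := (t * x + (1 - t) * y - w)%R.
have d0 : (0 < d)%R by rewrite subr_gt0.
have [|N1 H1] := @lt_limn_einf _ (phi_ ^~ r) (x - d)%:E.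
  by apply: lt_le_trans xr; rewrite lte_fin ltrBlDr ltrDl.
have [|N2 H2] := @lt_limn_einf _ (phi_ ^~ s) (y - d)%:E.
  by apply: lt_le_trans ys; rewrite lte_fin ltrBlDr ltrDl.
apply: (@le_limn_einf _ _ _ (maxn N1 N2)) => n; rewrite geq_max => /andP[n1 n2].
have := (ereal_convP _ t01 (rc_lty (rc n) ar) (rc_lty (rc n) as_)).1
  (rc_conc (rc n) ar as_ t01) _ _ (ltW (H1 _ n1)) (ltW (H2 _ n2)).
by apply: le_trans; rewrite lee_fin /d; lra.
Qed.

(* The upper semicontinuous hull of [psi]: its left limit at [r > a], and its
   value at [r = a]. *)
Definition limit_hull (r : R) : \bar R :=
  if (r < a)%R then 0
  else ereal_inf [set psi (a + t * (r - a))%R | t in [set t | (0 <= t < 1)%R]].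

Let hullE r : (a <= r)%R -> limit_hull r =
  ereal_inf [set psi (a + t * (r - a))%R | t in [set t | (0 <= t < 1)%R]].
Proof. by rewrite /limit_hull leNgt => /negbTE ->. Qed.

Let hull_le r t : (a <= r)%R -> (0 <= t < 1)%R ->
  limit_hull r <= psi (a + t * (r - a))%R.
Proof. by move=> ar t01; rewrite hullE//; apply: ereal_inf_lbound; exists t. Qed.

Let point_ge r t : (a <= r)%R -> (0 <= t)%R -> (a <= a + t * (r - a))%R.
Proof. by move=> ar t0; rewrite lerDl mulr_ge0// subr_ge0. Qed.

Lemma limit_hull_le : limit_hull a <= M%:E.
Proof.
apply: le_trans (psi_le (lexx a)); have := @hull_le a 0%R (lexx a).
by rewrite lexx ltr01 mul0r addr0; apply.
Qed.

Lemma limn_esup_le_hull r : (a <= r)%R -> limn_esup (phi_ ^~ r) <= limit_hull r.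
Proof.
move=> ar; rewrite hullE//; apply: le_ereal_inf_tmp => _ [t /andP[t0 t1] <-].
have /predU1P[<-|ar'] : (a == r) || (a < r)%R by rewrite -le_eqVlt.
  by rewrite subrr mulr0 addr0.
apply: Psi_le_psi; first exact: point_ge.
by rewrite -ltrBrDl gtr_pMl// subr_gt0.
Qed.

(** If [psi] is not [-oo] at some s > r > a, concavity between [s] and points left of [r] forbids a
    drop at [r]. Two drops y < z are impossible: a drop at [z] makes [psi] exceed [-oo] on the
    points between them. *)
Lemma hull_le_limn_einf : exists x0, forall r, (a <= r)%R -> r != x0 ->
  limit_hull r <= limn_einf (phi_ ^~ r).
Proof.
have at_a : limit_hull a <= psi a.
  by have := @hull_le a 0%R (lexx a); rewrite lexx ltr01 mul0r addr0; apply.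
have left_lim r s : (a < r)%R -> (r < s)%R -> -oo < psi s -> limit_hull r <= psi r.
  move=> ar rs psis; have as_ := ltW (lt_trans ar rs).
  have [z [_ zs]] := ereal_dense psis.
  apply: ereal_le_of_lt => x xr; apply: ereal_le_of_lt => w; rewrite lte_fin => wx.
  have [t [l [t01 l01 rE wE]]] := convex_split z ar rs wx.
  rewrite [in leRHS]rE; apply: (@le_trans _ _ (t * z + (1 - t) * x)%:E).
    by rewrite lee_fin.
  apply: psi_conc => //; last 2 first.
  - exact: ltW.
  - by apply: (le_trans (ltW xr)); apply: hull_le => //; exact: ltW.
  by apply: point_ge; [exact: ltW|case/andP: l01].
have [[x0 [ax0 x0lt]]|H] := pselect (exists x0, (a <= x0)%R /\ psi x0 < limit_hull x0).
  exists x0 => r ar rx0; rewrite leNgt; apply/negP => rlt.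
  have ne z : (a <= z)%R -> psi z < limit_hull z -> (a < z)%R.
    move=> az; have /predU1P[<-|//] : (a == z) || (a < z)%R by rewrite -le_eqVlt.
    by rewrite ltNge at_a.
  have absurd y z : (a <= y)%R -> (y < z)%R -> psi y < limit_hull y ->
      psi z < limit_hull z -> False.
    move=> ay yz ylt zlt; have az := ne _ (le_trans ay (ltW yz)) zlt.
    pose s := ((y + z) / 2)%R.
    have ys : (y < s)%R by rewrite (midf_lt yz).
    have sz : (s < z)%R by rewrite (midf_lt yz).
    have : limit_hull y <= psi y.
      apply: (left_lim _ s) => //; first exact: ne.
      apply: lt_le_trans (le_lt_trans (leNye _) zlt) _.
      have := @hull_le z ((s - a) / (z - a))%R (ltW az).
      rewrite divfK ?gt_eqF ?subr_gt0// (addrC a) subrK; apply.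
      rewrite divr_ge0 ?subr_ge0 ?(ltW az) ?(le_trans ay (ltW ys))//=.
      by rewrite ltr_pdivrMr ?subr_gt0// mul1r ltrD2r.
    by rewrite leNgt ylt.
  have [] := ltgtP r x0 => rx; last by rewrite rx eqxx in rx0.
    exact: absurd ar rx rlt x0lt.
  exact: absurd ax0 rx x0lt rlt.
(* There is no drop at all, so the excluded point is arbitrary. *)
exists 0%R => r ar _; rewrite leNgt; apply/negP => rlt; apply: H.
by exists r.
Qed.

Lemma ray_concave_hull : ray_concave a limit_hull.
Proof.
have lty r : (a <= r)%R -> limit_hull r < +oo.
  move=> ar; have := @hull_le r 0%R ar; rewrite lexx ltr01 mul0r addr0 => /(_ isT).
  by move=> h; apply: (le_lt_trans h); apply: le_lt_trans (psi_le (lexx a)) (ltry _).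
split => //.
- by move=> r ra; rewrite /limit_hull ra.
- move=> r N ar; rewrite hullE ?ltW// => /ereal_inf_lt[_ [t /andP[t0 t1] <-]] tN.
  (* As t < l < 1, the point with factor [t] relative to [r] has factor [t / l < 1] relative to [s],
     so it also counts in the infimum at [s]. *)
  pose l := ((1 + t) / 2)%R; pose s := (a + l * (r - a))%R.
  have l0 : (0 < l)%R by rewrite /l; lra.
  have l1 : (l < 1)%R by rewrite /l; lra.
  have as_ : (a <= s)%R by apply: point_ge; rewrite ltW.
  exists s; split => //; first by rewrite -ltrBrDl gtr_pMl// subr_gt0.
  apply: le_lt_trans tN; apply: le_trans (hull_le (t := (t / l)%R) as_ _) _.
    apply/andP; split; first by rewrite divr_ge0 ?(ltW l0).
    by rewrite ltr_pdivrMr// mul1r /l; lra.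
  by rewrite /s addrAC subrr add0r mulrA divfK// gt_eqF.
- move=> r s t ar as_ t01.
  have az : (a <= t * r + (1 - t) * s)%R by case/andP: t01 => *; nra.
  apply/ereal_convP => //; [exact: lty..|] => x y xr ys.
  rewrite hullE//; apply: le_ereal_inf_tmp => _ [l l01 <-].
  (* Contraction towards [a] commutes with convex combinations; hence the hull is written with a
     factor rather than as a plain left limit. *)
  have -> : (a + l * (t * r + (1 - t) * s - a)
      = t * (a + l * (r - a)) + (1 - t) * (a + l * (s - a)))%R by ring.
  have /andP[l0 _] := l01.
  apply: psi_conc => //; [exact: point_ge..| |].
  - exact: le_trans xr (hull_le _ _).
  - exact: le_trans ys (hull_le _ _).
- move=> r s ar rs; rewrite (hullE ar); apply: le_ereal_inf_tmp => _ [l l01 <-].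
  have /andP[l0 _] := l01.
  apply: (le_trans (hull_le (le_trans ar rs) l01)); apply: psi_dec; first exact: point_ge.
  by rewrite lerD2l ler_wpM2l// lerB.
Qed.

End ray_concave_limit.

(** * Existence and uniqueness of the maximizer *)

Section finite_criterion.
Context {R : realType} {p : nat}.
Notation mu := (@lebesgue_measure R).

Lemma expn_le_expR_half (x : R) (n : nat) : (0 <= x)%R ->
  (x ^+ n <= (2 * n%:R) ^+ n * expR (x / 2))%R.
Proof.
move=> x0; case: n => [|n].
  by rewrite !expr0 mul1r -expR0 ler_expR divr_ge0.
have := @expR_ge_expn _ (x / 2)%R n.+1 isT; rewrite divr_ge0// => /(_ isT).
move=> /(ler_wpM2l (exprn_ge0 n.+1 (mulr_ge0 (ler0n R 2) (ler0n R n.+1)))).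
rewrite -exprMn; congr (_ <= _)%R; congr (_ ^+ _)%R; field.
by rewrite ?nat1r ?natr1 pnatr_eq0.
Qed.

(** The competitor showing that the supremum is not [-oo]: it is integrable as soon as [Q] has a
    finite mean. *)
Definition linear_ray (a r : R) : \bar R := if (r < a)%R then 0 else (a - r)%:E.

Lemma linear_rayE a r : (a <= r)%R -> linear_ray a r = (a - r)%:E.
Proof. by rewrite /linear_ray leNgt => /negbTE ->. Qed.

Lemma ray_concave_linear a : ray_concave a (linear_ray a).
Proof.
split.
- by move=> r ra; rewrite /linear_ray ra.
- by move=> r ar; rewrite linear_rayE// ltry.
- move=> r M ar; rewrite linear_rayE ?ltW//; case: M => [M| |] rM; last 2 first.
  + by exists a; rewrite linear_rayE// ltry.
  + by move: rM; rewrite ltNge leNye.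
  rewrite lte_fin in rM.
  exists (Num.max a ((a - M + r) / 2))%R.
  have h : (a <= Num.max a ((a - M + r) / 2))%R by rewrite le_max lexx.
  rewrite linear_rayE// h gt_max ar lte_fin; split=> //; first by lra.
  by rewrite ltrBlDr -ltrBlDl lt_max; apply/orP; right; lra.
- move=> r s t ar as_ /andP[t0 t1]; rewrite !linear_rayE//; last by nra.
  by rewrite -!EFinM -EFinD lee_fin; lra.
- move=> r s ar rs; rewrite !linear_rayE ?(le_trans ar)// lee_fin lerB//.
Qed.

(** Half of the exponential decay absorbs the power; what remains is a multiple of the exponential
    density of rate 1/2, whence the factor 2 in [C]. *)
Lemma raymass_linear_lty (a : R) (n : nat) : (0 <= a)%R ->
  \int[mu]_(r in ray a) ((r ^+ n)%:E * expeR (linear_ray a r)) < +oo.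
Proof.
move=> a0; pose C := ((2 * n%:R) ^+ n * expR a * 2)%R.
have C0 : (0 <= C)%R by rewrite !mulr_ge0 ?exprn_ge0 ?expR_ge0.
pose f := @exponential_pdf R 2^-1.
have f0 x : (0 <= f x)%R by exact: exponential_pdf_ge0.
have mf D : measurable_fun D (EFin \o f).
  by apply/measurable_EFinP; apply: measurable_funTS; exact: measurable_exponential_pdf.
apply: (@le_lt_trans _ _ (\int[mu]_(r in ray a) (C%:E * (f r)%:E))).
  apply: ge0_le_integral => //.
  - by move=> r ar; rewrite mule_ge0 ?expeR_ge0// lee_fin exprn_ge0// (le_trans a0).
  - by apply: measurable_weight; apply: measurable_expeR_ray_concave;
      exact: ray_concave_linear.
  - by apply: emeasurable_funM => //; exact: mf.
  - move=> r ar; have r0 : (0 <= r)%R by exact: le_trans ar.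
    rewrite linear_rayE// /f exponential_pdfE// -!EFinM lee_fin.
    have := expn_le_expR_half n r0.
    move=> /(ler_wpM2r (expR_ge0 (a - r))) /le_trans; apply.
    rewrite le_eqVlt; apply/orP; left; apply/eqP.
    rewrite /C mulNr expRN expRD expRN.
    have -> : (expR r = expR (2^-1 * r) * expR (2^-1 * r))%R.
      by rewrite -expRD; congr expR; field.
    rewrite (mulrC r); field.
    by rewrite gt_eqF ?expR_gt0.
rewrite ge0_integralZl//; last 2 first.
- exact: mf.
- by move=> r _; rewrite lee_fin.
apply: (@le_lt_trans _ _ (C%:E * \int[mu]_r (f r)%:E)).
  apply: lee_wpmul2l; first by rewrite lee_fin.
  apply: ge0_subset_integral => //; [exact: mf|].
  by move=> r _; rewrite lee_fin.
by rewrite integral_exponential_pdf// mule1 ltry.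
Qed.

Variables (K : set 'rV[R]_p) (c a : R) (Q : probability (measurableTypeR R) R).
Hypotheses (p0 : (0 < p)%N) (a0 : (0 <= a)%R) (Qa : Q (ray a) = 1).
Hypotheses (c0 : (0 < c)%R) (Kc : p%:R%:E * lebesgue_outer K = c%:E).

Lemma L_linear_gtNy : \int[Q]_(r in ray a) r%:E < +oo ->
  -oo < L K a (linear_ray a) Q.
Proof.
move=> Qr; rewrite /L /mass Kc.
have intr : Q.-integrable (ray a) (fun r => r%:E).
  apply/integrableP; split; first exact/measurable_EFinP.
  rewrite [ltLHS](_ : _ = \int[Q]_(r in ray a) r%:E)//.
  apply: eq_integral => r; rewrite inE => ar.
  by rewrite gee0_abs// lee_fin (le_trans a0).
have inta : Q.-integrable (ray a) (EFin \o cst a).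
  exact: finite_measure_integrable_cst.
have : \int[Q]_(r in ray a) linear_ray a r \is a fin_num.
  rewrite [X in X \is a _](_ : _ = \int[Q]_(r in ray a) (a%:E - r%:E)); last first.
    by apply: eq_integral => r; rewrite inE => ar; rewrite linear_rayE.
  by apply: integrable_fin_num => //; exact: (integrableB _ inta intr).
move=> /fineK <-.
have := raymass_linear_lty p.-1 a0; have := raymass_ge0 (p := p) a0 (linear_ray a).
by case: (\int[mu]_(_ in _) _) => [v| |]// _ _; rewrite -EFinM -EFinB -EFinD ltNyr.
Qed.

Lemma L_le phi (M : R) : ray_concave a phi -> phi a <= M%:E ->
  L K a phi Q <= (M + 1)%:E.
Proof.
move=> rc phiM; have [LNy|] := eqVneq (L K a phi Q) -oo; first by rewrite LNy leNye.
rewrite -ltNye => /(L_fin a0 Qa c0 Kc rc)[x [m [E _ m0 ->]]].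
have := ray_concave_integral_le Qa rc (lexx a) E phiM phiM Qa.
rewrite subrr mul0r addr0 lee_fin => xM.
by rewrite lerD2r (le_trans _ xM)// lerBlDr lerDl mulr_ge0// ltW.
Qed.

End finite_criterion.

(** * Upper semicontinuity of the criterion along a maximizing sequence *)

Section maximizer.
Context {R : realType} {p : nat}.
Notation mu := (@lebesgue_measure R).
Variables (K : set 'rV[R]_p) (c a : R) (Q : probability (measurableTypeR R) R).
Hypotheses (p0 : (0 < p)%N) (a0 : (0 <= a)%R) (Qa : Q (ray a) = 1).
Hypotheses (c0 : (0 < c)%R) (Kc : p%:R%:E * lebesgue_outer K = c%:E).
Notation raymass phi :=
  (\int[mu]_(r in ray a) ((r ^+ p.-1)%:E * expeR (phi r))).

Section upper_limit.
Variables (phi_ : (R -> \bar R)^nat) (phi : R -> \bar R) (S M x0 : R).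
Hypotheses (rc_ : forall n, ray_concave a (phi_ n)) (rc : ray_concave a phi).
Hypothesis L_ : forall n, (S - n.+1%:R^-1)%:E <= L K a (phi_ n) Q.
Hypothesis phia : forall n, phi_ n a <= M%:E.
Hypothesis phi_aM : phi a <= M%:E.
Hypothesis phi_ge : forall r, (a <= r)%R -> limn_esup (phi_ ^~ r) <= phi r.
Hypothesis phi_le : forall r, (a <= r)%R -> r != x0 ->
  phi r <= limn_einf (phi_ ^~ r).

Let phi_M n r : ray a r -> phi_ n r <= M%:E.
Proof. by move=> ar; apply: le_trans (phia n); exact: (rc_dec (rc_ n)). Qed.

(** Subtracting from the common bound [M] gives nonnegative integrands and turns limsup into liminf.
    Since [Q] may have atoms, [phi_ge] is used at every point. *)
Lemma integral_gap_fatou : \int[Q]_(r in ray a) (M%:E - phi r) <=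
  limn_einf (fun n => \int[Q]_(r in ray a) (M%:E - phi_ n r)).
Proof.
have mphi_ n : measurable_fun (ray a) (fun r => M%:E - phi_ n r).
  by apply: emeasurable_funB => //; exact: measurable_ray_concave.
have E r : ray a r -> limn_einf (fun n => M%:E - phi_ n r)
    = M%:E - limn_esup (phi_ ^~ r).
  by move=> ar; rewrite limn_einf_shift// -limn_einfN.
apply: (@le_trans _ _ (\int[Q]_(r in ray a)
    limn_einf (fun n => M%:E - phi_ n r))); last first.
  by apply: fatou => // n r ar; rewrite sube_ge0 ?orbT// phi_M.
rewrite [leRHS](_ : _ = \int[Q]_(r in ray a) (M%:E - limn_esup (phi_ ^~ r))); last first.
  by apply: eq_integral => r; rewrite inE => ar; exact: E.
apply: ge0_le_integral => //.
- move=> r ar; rewrite sube_ge0 ?orbT//.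
  exact: le_trans (rc_dec rc (lexx a) ar) phi_aM.
- by apply: emeasurable_funB => //; exact: measurable_ray_concave.
- apply: emeasurable_funB => //; apply: measurable_fun_limn_esup => n.
  exact: measurable_ray_concave.
- by move=> r ar; rewrite leeB// phi_ge.
Qed.

(** The point [x0], where [phi] may exceed the limit inferior, is Lebesgue null. *)
Lemma raymass_fatou : raymass phi <= limn_einf (fun n => raymass (phi_ n)).
Proof.
have mw n : measurable_fun (ray a) (fun r => (r ^+ p.-1)%:E * expeR (phi_ n r)).
  by apply: measurable_weight; exact: measurable_expeR_ray_concave.
have w0 n r : ray a r -> 0 <= (r ^+ p.-1)%:E * expeR (phi_ n r).
  by move=> ar; rewrite mule_ge0 ?expeR_ge0// (weight_ge0 a0).
apply: (@le_trans _ _ (\int[mu]_(r in ray a)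
    limn_einf (fun n => (r ^+ p.-1)%:E * expeR (phi_ n r)))); last first.
  exact: fatou.
apply: ae_ge0_le_integral => //.
- by move=> r ar; rewrite mule_ge0 ?expeR_ge0// (weight_ge0 a0).
- by apply: measurable_weight; exact: measurable_expeR_ray_concave.
- by move=> r ar; apply: (@le_limn_einf _ _ _ 0%N) => n _; exact: w0.
- rewrite /limn_einf; apply: measurableT_comp => //.
  by apply: measurable_fun_limn_esup => n; apply: measurableT_comp (mw n).
exists [set x0]; split; [exact: measurable_set1|exact: lebesgue_measure_set1|].
move=> r /= /not_implyP[ar]; apply: contra_notP => /eqP rx0.
have w1 := weight_ge0 (p := p) a0 ar; rewrite lee_fin in w1.
apply: le_trans (limn_einf_pZl w1 (fun n => expeR_ge0 _)).
apply: lee_wpmul2l; first by rewrite lee_fin.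
by apply: le_trans (expeR_limn_einf _); rewrite lee_expeR phi_le.
Qed.

(** With [e] the integral of [M - phi] and [f] the mass, the criterion is M + 1 - (e + c f), so the
    goal is e + c f <= T, where both terms are lower semicontinuous. *)
Lemma L_upper_limit : S%:E <= L K a phi Q.
Proof.
pose E n : \bar R := \int[Q]_(r in ray a) (M%:E - phi_ n r).
have inta : Q.-integrable (ray a) (EFin \o cst M) by exact: finite_measure_integrable_cst.
have EF n : exists e f : R, [/\ E n = e%:E, raymass (phi_ n) = f%:E,
    (0 <= e)%R, (0 <= f)%R & (e + c * f <= M + 1 - S + n.+1%:R^-1)%R].
  have [x [f [xE fE f0 LE]]] := L_fin a0 Qa c0 Kc (rc_ n) (lt_le_trans (ltNyr _) (L_ n)).
  have := L_ n; rewrite LE lee_fin => Ln.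
  have intp : Q.-integrable (ray a) (phi_ n).
    by apply: ray_concave_integrable => //; rewrite xE ltNyr.
  have EE : E n = (M - x)%:E.
    by rewrite /E integralB// -[X in X - _]/(\int[Q]_(r in ray a) M%:E)
      integral_cst_ray// xE.
  exists (M - x)%R, f; split=> //; last first.
    by set z := (n.+1%:R^-1)%R in Ln *; lra.
  rewrite -lee_fin -EE; apply: integral_ge0 => r ar.
  by rewrite sube_ge0 ?orbT// phi_M.
pose T := (M + 1 - S)%R.
have n1 n : (n.+1%:R^-1 <= 1 :> R)%R by rewrite invf_le1 ?ler1n.
have Ele : limn_einf E <= (T + 1)%:E.
  apply: le_trans (limn_einf_sup _) _; apply: (@limn_esup_le _ _ _ 0%N) => n _.
  have [e [f [-> _ e0 f0 ef]]] := EF n; rewrite lee_fin /T.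
  have cf0 := mulr_ge0 (ltW c0) f0; have n_1 := n1 n.
  set z := (n.+1%:R^-1)%R in ef n_1; lra.
have Fle : limn_einf (fun n => raymass (phi_ n)) <= ((T + 1) / c)%:E.
  apply: le_trans (limn_einf_sup _) _; apply: (@limn_esup_le _ _ _ 0%N) => n _.
  have [e [f [_ -> e0 f0 ef]]] := EF n; rewrite lee_fin /T ler_pdivlMr//.
  have n_1 := n1 n.
  set z := (n.+1%:R^-1)%R in ef n_1; lra.
have E0 : 0 <= \int[Q]_(r in ray a) (M%:E - phi r).
  apply: integral_ge0 => r ar; rewrite sube_ge0 ?orbT//.
  exact: le_trans (rc_dec rc (lexx a) ar) phi_aM.
have F0 := raymass_ge0 (p := p) a0 phi.
have [e eE] : exists e : R, \int[Q]_(r in ray a) (M%:E - phi r) = e%:E.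
  have := le_trans integral_gap_fatou Ele; move: E0.
  by case: (\int[Q]_(_ in _) _) => [e| |]// _ _; exists e.
have [f fE] : exists f : R, raymass phi = f%:E.
  have := le_trans raymass_fatou Fle; move: F0.
  by case: (raymass _) => [f| |]// _ _; exists f.
have ef : (e + c * f <= T)%R.
  rewrite leNgt; apply/negP => Tef.
  (* Lowering [e] and [f] by [d] costs half of the excess over [T]; the other half outweighs the
     error [n.+1%:R^-1]. *)
  pose d := ((e + c * f - T) / (2 * (1 + c)))%R.
  have c1 : (0 < 1 + c)%R by rewrite addr_gt0.
  have d0 : (0 < d)%R by rewrite divr_gt0 ?subr_gt0 ?mulr_gt0.
  have dE : (d * (1 + c) = (e + c * f - T) / 2)%R by rewrite /d; field; rewrite gt_eqF.
  have [|N1 H1] := @lt_limn_einf _ E (e - d)%:E.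
    by apply: lt_le_trans integral_gap_fatou; rewrite eE lte_fin ltrBlDr ltrDl.
  have [|N2 H2] := @lt_limn_einf _ (fun n => raymass (phi_ n)) (f - d)%:E.
    by apply: lt_le_trans raymass_fatou; rewrite fE lte_fin ltrBlDr ltrDl.
  have T2 : (0 < (e + c * f - T) / 2)%R by rewrite divr_gt0// subr_gt0.
  have [N3 HN3] := ltr_add_invr T2.
  pose n := maxn N1 (maxn N2 N3).
  have := H1 n (leq_maxl _ _); have := H2 n (leq_trans (leq_maxl _ _) (leq_maxr _ _)).
  have [e' [f' [-> -> _ _ ef']]] := EF n; rewrite !lte_fin => ff' ee'.
  have nN3 : (n.+1%:R^-1 <= N3.+1%:R^-1 :> R)%R.
    rewrite lef_pV2 ?posrE ?ltr0n// ler_nat ltnS.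
    exact: leq_trans (leq_maxr _ _) (leq_maxr _ _).
  have cff' : (c * (f - d) < c * f')%R by rewrite ltr_pM2l.
  rewrite -/T in ef'; rewrite add0r in HN3.
  move: dE ef' ee' cff' nN3 HN3.
  set z := (n.+1%:R^-1)%R; set y := (N3.+1%:R^-1)%R.
  by lra.
have mphi := measurable_ray_concave rc.
have intMphi : Q.-integrable (ray a) (fun r => M%:E - phi r).
  apply/integrableP; split; first exact: emeasurable_funB.
  rewrite [ltLHS](_ : _ = e%:E) ?ltry// -eE; apply: eq_integral => r.
  rewrite inE => ar; rewrite gee0_abs// sube_ge0 ?orbT//.
  exact: le_trans (rc_dec rc (lexx a) ar) phi_aM.
have phiE : \int[Q]_(r in ray a) phi r = (M - e)%:E.
  transitivity (\int[Q]_(r in ray a) (M%:E - (M%:E - phi r))).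
    apply: eq_integral => r _.
    by case: (phi r) => [y| |]//=; rewrite -!EFinB opprB addrC subrK.
  by rewrite integralB// -[X in X - _]/(\int[Q]_(r in ray a) M%:E)
    integral_cst_ray// eE.
rewrite /L /mass Kc fE phiE -EFinM -EFinB -EFinD lee_fin.
by rewrite /T in ef; lra.
Qed.

End upper_limit.
End maximizer.

Lemma set1_get {T : pointedType} (A : set T) (x : T) : A x ->
  (forall y, A y -> y = x) -> A = [set get A].
Proof.
move=> Ax xA; have Ag : A (get A) by apply: getPex; exists x.
apply/seteqP; split => y /=; last by move=> ->.
by move=> /xA ->; rewrite -(xA _ Ag).
Qed.

(** * Finite supremum, existence and uniqueness *)

Section unique_maximizer.
Context {R : realType} {p : nat}.
Variables (K : set 'rV[R]_p) (c a : R) (Q : probability (measurableTypeR R) R).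
Hypotheses (p0 : (0 < p)%N) (a0 : (0 <= a)%R) (Qa : Q (ray a) = 1).
Hypotheses (c0 : (0 < c)%R) (Kc : p%:R%:E * lebesgue_outer K = c%:E).
Hypotheses (Qr : \int[Q]_(r in ray a) r%:E < +oo) (Q1 : Q [set a] < 1).

Let sup := ereal_sup [set L K a phi Q | phi in Phi_ a].

(** Coercivity at level 0 bounds [phi a], hence the criterion, whenever the latter is positive. *)
Lemma L_sup_fin : sup \is a fin_num.
Proof.
have rc0 := ray_concave_linear a.
have [b [q [ab q0 Qb]]] := exists_tail_mass Qa Q1.
have [M HM] := L_coercive p0 a0 Qa c0 Kc 0%R ab q0 Qb.
rewrite fin_numElt; apply/andP; split.
  apply: lt_le_trans (L_linear_gtNy a0 Kc Qr) _.
  by apply: ereal_sup_ubound; exists (linear_ray a) => //; apply/Phi_aP.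
apply: (@le_lt_trans _ _ (Num.max 0 (M + 1))%:E); last exact: ltry.
apply: ge_ereal_sup => _ [phi /Phi_aP rc <-].
have [L0|/ltW L0] := leP 0 (L K a phi Q); last first.
  by rewrite (le_trans L0)// lee_fin le_max lexx.
have [phiM _] := HM _ rc L0.
apply: le_trans (L_le a0 Qa c0 Kc rc phiM) _.
by rewrite lee_fin le_max lexx orbT.
Qed.

Let le_sup phi : ray_concave a phi -> L K a phi Q <= (fine sup)%:E.
Proof.
move=> rc; rewrite fineK ?L_sup_fin//; apply: ereal_sup_ubound.
by exists phi => //; apply/Phi_aP.
Qed.

Lemma maximizer_exists :
  exists2 phi, ray_concave a phi & L K a phi Q = sup.
Proof.
set S := fine sup.
have /choice[phi_ phi_P] n : exists phi, ray_concave a phi /\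
    (S - n.+1%:R^-1)%:E <= L K a phi Q.
  have n0 : (0 < n.+1%:R^-1 :> R)%R by rewrite invr_gt0.
  have [_ [phi /Phi_aP rc <-] Lphi] := ub_ereal_sup_adherent n0 L_sup_fin.
  by exists phi; split => //; rewrite EFinB fineK ?L_sup_fin// ltW.
have rc_ n := (phi_P n).1; have L_ n := (phi_P n).2.
have [b [q [ab q0 Qb]]] := exists_tail_mass Qa Q1.
(* The level [S - 1] suits the whole sequence, as its errors are at most 1. *)
have [M HM] := L_coercive p0 a0 Qa c0 Kc (S - 1)%R ab q0 Qb.
have S1 n : (S - 1)%:E <= L K a (phi_ n) Q.
  apply: le_trans (L_ n); rewrite lee_fin lerB//.
  by rewrite invf_le1 ?ler1n.
have phia n : phi_ n a <= M%:E by have [] := HM _ (rc_ n) (S1 n).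
have phib n : (- M)%:E <= phi_ n b by have [] := HM _ (rc_ n) (S1 n).
have gap (s r u v : R) : (a <= s)%R -> (s < r)%R -> (u < v)%R ->
    exists N, forall n m, (N <= n)%N -> (N <= m)%N ->
      phi_ m s <= u%:E -> v%:E <= phi_ n r -> False.
  move=> as_ sr uv.
  (* The left-hand side of [near_maximizers_gap], violated once the error is below [g / 2]. *)
  pose g := (c * ((expR (v / 2) - expR (u / 2)) ^+ 2 * ((r - s) / 2) ^+ p))%R.
  have g0 : (0 < g / 2)%R.
    rewrite divr_gt0// mulr_gt0// mulr_gt0//.
      by rewrite exprn_gt0// subr_gt0 ltr_expR ltr_pM2r// invr_gt0.
    by rewrite exprn_gt0// divr_gt0// subr_gt0.
  have [N] := ltr_add_invr g0; rewrite add0r => Ng.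
  exists N => n m Nn Nm phiu phiv.
  have LN k : (N <= k)%N -> (S - N.+1%:R^-1)%:E <= L K a (phi_ k) Q.
    move=> Nk; apply: le_trans (L_ k); rewrite lee_fin lerB//.
    by rewrite lef_pV2 ?posrE// ler_nat.
  have := near_maximizers_gap p0 a0 Qa c0 Kc (rc_ n) (rc_ m) le_sup
    (LN _ Nn) (LN _ Nm) as_ sr (ltW uv) phiu phiv.
  apply/negP; rewrite -ltNge -/g -ltr_pdivlMl// mulrC //.
have rc := ray_concave_hull rc_ phia.
have [x0 x0P] := hull_le_limn_einf rc_.
exists (limit_hull a phi_) => //; apply/eqP; rewrite eq_le.
have fs := L_sup_fin; rewrite -(fineK fs) le_sup//=.
apply: (L_upper_limit a0 Qa c0 Kc rc_ rc L_ phia _ _ x0P).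
- exact: limit_hull_le rc_ phia.
- by move=> r ar; exact: limn_esup_le_hull ab rc_ phib gap _ ar.
Qed.

Lemma maximizer_unique phi1 phi2 : ray_concave a phi1 -> ray_concave a phi2 ->
  L K a phi1 Q = sup -> L K a phi2 Q = sup -> phi1 = phi2.
Proof.
have [b [q [ab q0 Qb]]] := exists_tail_mass Qa Q1.
suff le12 phi psi r : ray_concave a phi -> ray_concave a psi ->
    L K a phi Q = sup -> L K a psi Q = sup -> (a <= r)%R -> phi r <= psi r.
  move=> rc1 rc2 L1 L2; apply/funext => r; have [ra|ar] := ltP r a.
    by rewrite (rc_out rc1)// (rc_out rc2).
  by apply/eqP; rewrite eq_le !le12.
move=> rc1 rc2 L1 L2.
have S1 : (fine sup - 0)%:E <= L K a phi Q by rewrite subr0 fineK ?L_sup_fin// L1.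
have S2 : (fine sup - 0)%:E <= L K a psi Q by rewrite subr0 fineK ?L_sup_fin// L2.
have lt_le s z : (a <= s)%R -> (s < z)%R -> phi z <= psi s.
  move=> as_ sz; rewrite leNgt; apply/negP => /ereal_dense[u [su uz]].
  have [v [uv vz]] := ereal_dense uz; rewrite lte_fin in uv.
  have := near_maximizers_gap p0 a0 Qa c0 Kc rc1 rc2 le_sup S1 S2 as_ sz
    (ltW uv) (ltW su) (ltW vz).
  apply/negP; rewrite -ltNge mulr0 mulr_gt0// mulr_gt0//.
    by rewrite exprn_gt0// subr_gt0 ltr_expR ltr_pM2r// invr_gt0.
  by rewrite exprn_gt0// divr_gt0// subr_gt0.
have [/eqP ra|ra] := eqVneq r a; last first.
  move=> ar; have {ar ra} ar : (a < r)%R by rewrite lt_neqAle eq_sym ra.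
  (* By left continuity, [psi r < phi r] would give [psi s < phi r] for some s < r. *)
  rewrite leNgt; apply/negP => /(rc_left rc2 ar)[s [as_ sr]].
  by apply/negP; rewrite -leNgt lt_le.
(* At [a], concavity and the lower bound at [b] again replace left continuity. *)
move=> _; rewrite (eqP ra).
have [M HM] := L_coercive p0 a0 Qa c0 Kc (fine sup) ab q0 Qb.
rewrite subr0 in S1; have [_ phib] := HM _ rc1 S1.
apply: ereal_le_of_lt => x xa; apply: ereal_le_of_lt => w; rewrite lte_fin => wx.
have half0 : (0 < 2^-1 :> R)%R by rewrite invr_gt0.
have [t [t0 t12 wt]] := small_weight (- M) wx half0.
have t01 : (0 < t < 1)%R by rewrite t0 (le_lt_trans t12)// invf_lt1// ltr1n.
have at_ : (a < t * b + (1 - t) * a)%R.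
  have -> : (t * b + (1 - t) * a = a + t * (b - a))%R by ring.
  by rewrite ltrDl mulr_gt0// subr_gt0.
apply: le_trans (lt_le _ _ (lexx a) at_).
have lb := rc_lty rc1 (ltW ab); have la := rc_lty rc1 (lexx a).
have /(ereal_convP _ t01 lb la) := rc_conc rc1 (ltW ab) (lexx a) t01.
by move=> /(_ _ _ phib (ltW xa)); apply: le_trans; rewrite lee_fin.
Qed.

Lemma argmax_L_phi_star :
  argmax (Phi_ a) (fun phi => L K a phi Q) = [set phi_star K a Q].
Proof.
have [phi rc Lphi] := maximizer_exists.
have maxP psi : argmax (Phi_ a) (fun phi => L K a phi Q) psi ->
    ray_concave a psi /\ L K a psi Q = sup.
  move=> [/Phi_aP rcpsi Lpsi]; split=> //; apply/eqP; rewrite eq_le.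
  rewrite -{2}Lphi Lpsi ?andbT; last exact/Phi_aP.
  by apply: ereal_sup_ubound; exists psi => //; exact/Phi_aP.
apply: (set1_get (x := phi)).
  split; first exact/Phi_aP.
  by move=> psi psiP; rewrite Lphi; apply: ereal_sup_ubound; exists psi.
by move=> psi /maxP[rcpsi Lpsi]; exact: maximizer_unique.
Qed.

End unique_maximizer.

(** * Degenerate measures *)

Section degenerate_measures.
Context {R : realType} {p : nat}.
Notation mu := (@lebesgue_measure R).
Variables (K : set 'rV[R]_p) (c a : R) (Q : probability (measurableTypeR R) R).
Hypotheses (p0 : (0 < p)%N) (a0 : (0 <= a)%R) (Qa : Q (ray a) = 1).
Hypotheses (c0 : (0 < c)%R) (Kc : p%:R%:E * lebesgue_outer K = c%:E).

(** Beyond [s], concavity keeps [phi] below the chord from (a, m) to (s, y), of slope [- B]. The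
    intercept [m + B * s] raises this line to height [m] at [s], so that it also dominates [phi] on
    [a, s]. *)
Lemma ray_concave_affine_bound phi (m y s : R) : ray_concave a phi ->
  phi a = m%:E -> (a < s)%R -> phi s <= y%:E -> (y < m)%R ->
  exists A B : R, (0 < B)%R /\ forall r, (a <= r)%R -> phi r <= (A - B * r)%:E.
Proof.
move=> rc phia as_ phis ym; pose B := ((m - y) / (s - a))%R.
have sa : (0 < s - a)%R by rewrite subr_gt0.
have B0 : (0 < B)%R by rewrite divr_gt0// subr_gt0.
exists (m + B * s)%R, B; split => // r ar; have [rs|sr] := leP r s.
  apply: (le_trans (rc_dec rc (lexx a) ar)).
  by rewrite phia lee_fin -addrA -mulrBr lerDl mulr_ge0 ?(ltW B0)// subr_ge0.
apply: ereal_le_of_lt => v /ltW vr.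
have ra : (0 < r - a)%R by rewrite subr_gt0 (lt_trans as_).
pose t := ((s - a) / (r - a))%R.
have tE : (t * (r - a) = s - a)%R by rewrite divfK// gt_eqF.
have t01 : (0 < t < 1)%R by rewrite divr_gt0//= ltr_pdivrMr// mul1r ltrD2r.
have lr := rc_lty rc ar; have la := rc_lty rc (lexx a).
have /(ereal_convP _ t01 lr la) := rc_conc rc ar (lexx a) t01.
have -> : (t * r + (1 - t) * a = s)%R by rewrite -[RHS](subrK a) -tE; ring.
rewrite phia => /(_ _ _ vr (lexx _)) /le_trans/(_ phis); rewrite !lee_fin => tv.
have Bt : (B * t * (r - a) = m - y)%R.
  by rewrite -mulrA tE /B divfK// gt_eqF.
have vB : (v <= m - B * (r - a))%R.
  have /andP[t0 _] := t01; rewrite -(ler_pM2l t0).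
  by apply: (@le_trans _ _ (y - (1 - t) * m)%R); lra.
by have := ler_pM2l B0 a s; rewrite (ltW as_) => /idP; lra.
Qed.

(** If the criterion is finite, a constant [phi] has infinite mass, and a nonconstant one decreases
    at least linearly, so its integrability bounds the mean of [Q]. *)
Lemma L_infinite_mean phi : \int[Q]_(r in ray a) r%:E = +oo ->
  ray_concave a phi -> L K a phi Q = -oo.
Proof.
move=> Qr rc; apply: contrapT => /eqP; rewrite -ltNye => L0.
have [x [f [xE fE f0 _]]] := L_fin a0 Qa c0 Kc rc L0.
have [m phia] : exists m : R, phi a = m%:E.
  have := rc_lty rc (lexx a); case E : (phi a) => [m| |]// _; first by exists m.
  have phix : phi a <= (x - 1)%:E by rewrite E leNye.
  have := ray_concave_integral_le Qa rc (lexx a) xE phix phix Qa.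
  by rewrite subrr mul0r addr0; lra.
have [H|H] := pselect (exists s, (a <= s)%R /\ phi s != phi a); last first.
  have cst r : (a <= r)%R -> phi r = m%:E.
    move=> ar; rewrite -phia; apply: contrapT => /eqP ne; apply: H.
    by exists r.
  (* On an interval of length [2 * t] the mass is at least [expR m * t ^+ p], which is at least
     [expR m * t > f] because [1 <= t]. *)
  pose t := (Num.max 1 (f / expR m + 1))%R.
  have t1 : (1 <= t)%R by rewrite le_max lexx.
  have t0 : (0 < t)%R by rewrite (lt_le_trans _ t1).
  have : ((expR m) * ((a + 2 * t - a) / 2) ^+ p)%:E <= f%:E.
    rewrite -fE; apply: weighted_integral_ge => //.
    - by rewrite ltrDl mulr_gt0.
    - exact: measurable_expeR_ray_concave.
    - by move=> r _; exact: expeR_ge0.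
    - by move=> r /andP[ar _]; rewrite cst.
  rewrite lee_fin; apply/negP; rewrite -ltNge.
  have -> : ((a + 2 * t - a) / 2 = t)%R by field.
  apply: (@lt_le_trans _ _ (expR m * t)%R).
    rewrite mulrC -ltr_pdivrMr ?expR_gt0// lt_max; apply/orP; right.
    by rewrite ltrDl.
  by rewrite ler_pM2l ?expR_gt0// -[leLHS]expr1 ler_weXn2l.
have [s [as_ sa]] := H.
have ltsa : phi s < phi a by rewrite lt_neqAle sa (rc_dec rc).
have {}as_ : (a < s)%R.
  by rewrite lt_neqAle as_ andbT; apply: contra_neq sa => ->.
have [y [sy ym]] := ereal_dense ltsa; rewrite phia lte_fin in ym.
have [A [B [B0 phiAB]]] := ray_concave_affine_bound rc phia as_ (ltW sy) ym.
have : \int[Q]_(r in ray a) (B%:E * r%:E) <= \int[Q]_(r in ray a) (A%:E - phi r).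
  have mphi := measurable_ray_concave rc.
  apply: ge0_le_integral => //.
  - move=> r ar; rewrite mule_ge0// lee_fin ?(ltW B0)//; exact: le_trans ar.
  - by apply/measurable_EFinP; exact: measurable_funM.
  - exact: emeasurable_funB.
  - move=> r ar; have := phiAB r ar; have := rc_lty rc ar.
    case: (phi r) => [z| |]//= _; last by rewrite leey.
    by rewrite -EFinM -EFinB !lee_fin lerBrDr -lerBrDl.
rewrite ge0_integralZl//; last 2 first.
- by move=> r ar; rewrite lee_fin; exact: le_trans ar.
- by rewrite lee_fin ltW.
have intp : Q.-integrable (ray a) phi.
  by apply: ray_concave_integrable => //; rewrite xE ltNyr.
have inta : Q.-integrable (ray a) (EFin \o cst A) by exact: finite_measure_integrable_cst.
rewrite integralB// -[X in _ <= X - _]/(\int[Q]_(r in ray a) A%:E).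
by rewrite integral_cst_ray// xE -EFinB [X in _ * X]Qr mulry gtr0_sg// mul1e leye_eq.
Qed.

(** For [Q] concentrated at [a] and [d = expR (- n)], the first term is [n] while the height
    [expR n] and the width [d] cancel in the mass, which stays bounded. *)
Definition step_ray (n d r : R) : \bar R :=
  if (r < a)%R then 0 else if (r <= a + d)%R then n%:E else -oo.

Lemma ray_concave_step n d : (0 <= d)%R -> ray_concave a (step_ray n d).
Proof.
move=> d0; rewrite /step_ray.
have E r : (a <= r)%R -> (r < a)%R = false by rewrite leNgt => /negbTE.
have ad : (a <= a + d)%R by rewrite lerDl.
split.
- by move=> r ->.
- by move=> r ar; rewrite E//; case: ifP; rewrite ?ltry.
- move=> r M ar; rewrite (E _ (ltW ar)); have [rd nM|rd NM] := leP r (a + d)%R.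
    by exists a; rewrite ltxx ad.
  have h1 : (a + d < (a + d + r) / 2)%R by rewrite (midf_lt rd).
  have h2 : ((a + d + r) / 2 < r)%R by rewrite (midf_lt rd).
  exists ((a + d + r) / 2)%R.
  have h3 := le_trans ad (ltW h1).
  by split => //; rewrite E// leNgt h1.
- move=> r s t ar as_ t01.
  have az : (a <= t * r + (1 - t) * s)%R by case/andP: t01 => *; nra.
  rewrite !E//; apply/ereal_convP => //; try by case: ifP; rewrite ?ltry.
  move=> x y; case: ifP => rd; last by rewrite leeNy_eq.
  case: ifP => sd; last by rewrite leeNy_eq.
  rewrite !lee_fin => xn yn; case/andP: t01 => t0 t1.
  rewrite ifT; last by nra.
  by rewrite lee_fin; nra.
- move=> r s ar rs; rewrite !E ?(le_trans ar)//; case: ifP => sd; rewrite ?leNye//.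
  by rewrite (le_trans rs sd).
Qed.

Lemma L_step_ge n : (0 <= n)%R -> Q [set a] = 1 ->
  (n - c * (a + 1) ^+ p.-1 + 1)%:E <= L K a (step_ray n (expR (- n))) Q.
Proof.
move=> n0 Q1; set d := expR (- n); set phi := step_ray n d.
have d0 : (0 < d)%R by exact: expR_gt0.
have d1 : (d <= 1)%R by rewrite /d -expR0 ler_expR oppr_le0.
have rc : ray_concave a phi by exact/ray_concave_step/ltW.
have phiE : \int[Q]_(r in ray a) phi r = n%:E.
  rewrite -(integral_cst_ray Qa); apply: ae_eq_integral => //.
    exact: measurable_ray_concave.
  exists (~` [set a]); split; first exact: measurableC.
    have : Q (~` [set a]) = 1 - Q [set a] by exact: probability_setC.
    by rewrite Q1 subee.
  move=> r /=; apply: contra_not => -> _.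
  by rewrite /phi /step_ray ltxx lerDl ltW.
have massE : \int[mu]_(r in ray a) ((r ^+ p.-1)%:E * expeR (phi r))
    <= ((a + 1) ^+ p.-1)%:E.
  have k0 : (0 <= (a + 1) ^+ p.-1 * expR n)%R.
    by rewrite mulr_ge0 ?exprn_ge0 ?expR_ge0 ?addr_ge0.
  apply: (@le_trans _ _ (\int[mu]_(r in ray a)
      (((a + 1) ^+ p.-1 * expR n)%:E * (\1_(`[a, a + d]%classic : set R) r)%:E))).
    apply: ge0_le_integral => //.
    - by move=> r ar; rewrite mule_ge0 ?expeR_ge0// (weight_ge0 a0).
    - by apply: measurable_weight; exact: measurable_expeR_ray_concave.
    - apply: emeasurable_funM => //.
      by apply/measurable_EFinP; exact: measurable_indic.
    - move=> r ar; rewrite indicE /phi /step_ray ltNge ar/=.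
      have [rd|rd] := leP r (a + d)%R; last by rewrite mule0 mule_ge0// lee_fin k0.
      rewrite mem_set/= ?in_itv/= ?rd ?andbT// -!EFinM mulr1 lee_fin.
      rewrite ler_wpM2r ?expR_ge0//; have r0 : (0 <= r)%R by exact: le_trans ar.
      by rewrite lerXn2r// ?nnegrE ?addr_ge0// (le_trans rd)// lerD2l.
  rewrite ge0_integralZl//; last first.
    by apply/measurable_EFinP; exact: measurable_indic.
  rewrite integral_indic// setIidl; last first.
    by move=> r /=; rewrite in_itv/= => /andP[].
  rewrite /= lebesgue_measure_itv/= lte_fin ltrDl d0 -EFinB addrAC subrr add0r.
  by rewrite -EFinM lee_fin -mulrA -expRD subrr expR0 mulr1.
have := raymass_ge0 (p := p) a0 phi.
rewrite /L /mass Kc phiE; move: massE.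
case: (\int[mu]_(_ in _) _) => [v| |]//; rewrite !lee_fin => va v0.
by rewrite lerD2r lerB// ler_pM2l.
Qed.

Lemma L_sup_dirac : Q [set a] = 1 ->
  ereal_sup [set L K a phi Q | phi in Phi_ a] = +oo.
Proof.
move=> Q1; apply/eqP; rewrite -leye_eq; apply: ereal_le_of_lt => x _.
pose n := (Num.max 0 (x + c * (a + 1) ^+ p.-1))%R.
have n0 : (0 <= n)%R by rewrite le_max lexx.
apply: (@le_trans _ _ (L K a (step_ray n (expR (- n))) Q)).
  apply: le_trans (L_step_ge n0 Q1); rewrite lee_fin.
  have : (x + c * (a + 1) ^+ p.-1 <= n)%R by rewrite le_max lexx orbT.
  lra.
apply: ereal_sup_ubound; exists (step_ray n (expR (- n))) => //.
by apply/Phi_aP/ray_concave_step/expR_ge0.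
Qed.

End degenerate_measures.

(** * Gauge norms *)

Section gauge.
Context {R : realType} {p : nat}.
Variable K : set 'rV[R]_p.
Hypothesis hK : convex_body K.
Implicit Types x y : 'rV[R]_p.

Let gauge_set x : set R := [set t | (0 <= t)%R /\ [set t *: y | y in K]%R x].

Lemma convex_body_ball : exists2 e : R, (0 < e)%R & forall x, (`|x| < e)%R -> K x.
Proof.
have [_ _ /nbhs_ballP[e /= e0 eK]] := hK; exists e => // x xe; apply: eK.
by rewrite -ball_normE/= sub0r normrN.
Qed.

Lemma convex_body_bounded : exists2 N : R, (0 < N)%R & forall x, K x -> (`|x| <= N)%R.
Proof.
have [/compact_bounded[M [_ HM]] _ _] := hK.
exists (Num.max M 0 + 1)%R; first by rewrite ltr_wpDl// le_max lexx orbT.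
by apply: HM; rewrite ltr_pwDr// le_max lexx.
Qed.

Let gauge_set_neq0 x : gauge_set x !=set0.
Proof.
have [e e0 eK] := convex_body_ball.
pose t := ((`|x| + 1) / e)%R.
have t0 : (0 < t)%R by rewrite divr_gt0// ltr_wpDl.
exists t; split; first exact: ltW.
exists (t^-1 *: x)%R; last by rewrite scalerA divff ?scale1r// gt_eqF.
apply: eK; rewrite normrZ gtr0_norm ?invr_gt0// invf_div mulrAC ltr_pdivrMr ?ltr_wpDl//.
by rewrite ltr_pM2l// ltrDl.
Qed.

Let gauge_le x t : gauge_set x t -> (gauge_norm K x <= t)%R.
Proof. by move=> xt; apply: ge_inf => //; exists 0%R => s []. Qed.

Lemma gauge_norm_ge0 x : (0 <= gauge_norm K x)%R.
Proof. by apply: lb_le_inf; [exact: gauge_set_neq0|move=> t []]. Qed.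

Let gauge_lt x r : (gauge_norm K x < r)%R -> exists t y,
  [/\ (0 <= t)%R, (t < r)%R, K y & x = (t *: y)%R].
Proof.
move=> /(inf_lt (gauge_set_neq0 x))[t [t0 [y Ky <-]]] tr.
by exists t, y.
Qed.

(** A small perturbation of t y with [y] in [K] has the form t y + d w with [w] in [K], and lies in
    (t + d) K by convexity. *)
Lemma open_gauge_lt r : open [set x | (gauge_norm K x < r)%R].
Proof.
rewrite openE => x /= /gauge_lt[t [y [t0 tr Ky ->]]].
have [e e0 eK] := convex_body_ball.
pose d := ((r - t) / 2)%R.
have d0 : (0 < d)%R by rewrite divr_gt0// subr_gt0.
apply/nbhs_ballP; exists (d * e)%R => /=; first exact: mulr_gt0.
move=> z; rewrite -ball_normE/= distrC => zd.
pose w := (d^-1 *: (z - t *: y))%R.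
have Kw : K w.
  apply: eK; rewrite normrZ gtr0_norm ?invr_gt0//.
  by rewrite mulrC ltr_pdivrMr// mulrC.
have td0 : (0 < t + d)%R by rewrite ltr_wpDl.
apply: (@le_lt_trans _ _ (t + d)%R); last by rewrite /d; lra.
apply: gauge_le; split; first exact: ltW.
have l01 : (0 <= t / (t + d) <= 1)%R.
  by rewrite divr_ge0 ?(ltW td0)//= ler_pdivrMr// mul1r lerDl ltW.
have [_ Kconv _] := hK.
have := Kconv y w (Itv01 (andP l01).1 (andP l01).2).
rewrite !inE => /(_ Ky Kw) Kv.
exists (t / (t + d) *: y + (1 - t / (t + d)) *: w)%R => //.
rewrite scalerDr !scalerA mulrBr mulr1 mulrCA divff ?gt_eqF// mulr1.
by rewrite addrAC subrr add0r divff ?gt_eqF// scale1r addrC subrK.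
Qed.

(** If [K] lies in the ball of radius [N], the gauge of x is at least |x|/N. This matches the atom
    of [P] at the origin with that of [Q] at 0. *)
Lemma gauge_norm_le0 : [set x | (gauge_norm K x <= 0)%R] = [set 0%R].
Proof.
have [N N0 KN] := convex_body_bounded.
apply/seteqP; split => x /=; last first.
  move=> ->; apply: gauge_le; split => //; exists 0%R; last by rewrite scale0r.
  by have [e e0 eK] := convex_body_ball; apply: eK; rewrite normr0.
move=> x0; apply/eqP; rewrite -normr_le0 leNgt; apply/negP => nx.
have /gauge_lt[t [y [t0 tx Ky xE]]] : (gauge_norm K x < `|x| / N)%R.
  by apply: (le_lt_trans x0); rewrite divr_gt0.
have : (`|x| < `|x|)%R; last by rewrite ltxx.
rewrite {1}xE normrZ ger0_norm//.
apply: (@le_lt_trans _ _ (t * N)%R); first by rewrite ler_wpM2l// KN.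
by rewrite -ltr_pdivlMr.
Qed.

Lemma measurable_gauge_norm :
  measurable_fun [set: borel_rV R p] (gauge_norm K : borel_rV R p -> measurableTypeR R).
Proof.
apply: (measurability _ (RGenInftyO.measurableE R)) => _ [_ [r ->] <-].
rewrite setTI; apply: sub_sigma_algebra.
rewrite (_ : _ @^-1` _ = [set x | (gauge_norm K x < r)%R]).
  exact: open_gauge_lt.
by apply/seteqP; split => x /=; rewrite in_itv.
Qed.

End gauge.

(** * The law of the gauge norm *)

Section gauge_distribution.
Context {R : realType} {p : nat}.
Variable K : set 'rV[R]_p.
Hypothesis hK : convex_body K.
Variables (P : probability (borel_rV R p) R).
Notation g := (gauge_norm K : borel_rV R p -> measurableTypeR R).

Lemma exists_gauge_distribution : exists Q : probability (measurableTypeR R) R,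
  prob_on_ray 0 Q /\ forall r : R, (0 <= r)%R ->
    Q [set s | (0 <= s < r)%R] = P [set x | (gauge_norm K x < r)%R].
Proof.
pose mg := isMeasurableFun.Build _ _ _ _ _ (measurable_gauge_norm hK).
pose X : {mfun borel_rV R p >-> measurableTypeR R} := HB.pack g mg.
exists (distribution P X); split.
  rewrite /prob_on_ray /distribution /pushforward/= -(probability_setT P).
  by congr (P _); apply/seteqP; split => x //= _; exact: gauge_norm_ge0.
move=> r r0; rewrite /distribution /pushforward/=.
congr (P _); apply/seteqP; split => x /=; first by move=> /andP[].
by move=> ->; rewrite andbT gauge_norm_ge0.
Qed.

Variable Q : probability (measurableTypeR R) R.
Hypothesis Q0 : prob_on_ray 0 Q.
Hypothesis QP : forall r : R, (0 <= r)%R ->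
  Q [set s | (0 <= s < r)%R] = P [set x | (gauge_norm K x < r)%R].

Lemma gauge_distribution_unique A : measurable A -> Q A = pushforward P g A.
Proof.
pose mg := isMeasurableFun.Build _ _ _ _ _ (measurable_gauge_norm hK).
pose X : {mfun borel_rV R p >-> measurableTypeR R} := HB.pack g mg.
move=> mA; rewrite -[RHS]/(distribution P X A).
(* [QP] speaks only of [0, r), whereas the generating half-lines extend to [-oo]; their negative
   parts are null. *)
have Qneg B : B `<=` ~` ray 0%R -> measurable B -> Q B = 0.
  move=> B0 mB; apply/eqP; rewrite -measure_le0.
  have <- : Q (~` ray 0%R) = 0.
    have : Q (~` ray 0%R) = 1 - Q (ray 0%R).
      by apply: probability_setC; exact: measurable_ray.
    by rewrite Q0 subee.
  by apply: le_measure; rewrite ?inE//; apply: measurableC; exact: measurable_ray.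
apply: (@g_sigma_algebra_measure_unique _ R (measurableTypeR R) (@RGenInftyO.G R) _
  (fun n : nat => `]-oo, (n%:R : R)%R[%classic) _ _ Q (distribution P X)).
- by move=> _ [r ->]; exact: measurable_itv.
- by move=> n; exists n%:R%R.
- apply/seteqP; split => // x _; exists (Num.bound `|x|%R) => //=.
  by rewrite in_itv/= (le_lt_trans (ler_norm x))// archi_boundP.
- move=> _ _ [r ->] [s ->]; exists (Num.min r s).
  by apply/seteqP; split => x /=; rewrite !in_itv/= lt_min => /andP.
- move=> _ [r ->]; transitivity (P [set x | (gauge_norm K x < r)%R]); last first.
    by congr (P _); apply/seteqP; split => x /=; rewrite in_itv.
  have [r0|r0] := leP 0%R r; last first.
    transitivity (0 : \bar R).
      apply: Qneg => // s /=; rewrite in_itv/= => sr; rewrite /ray/=; apply/negP.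
      by rewrite -ltNge (lt_trans sr).
    rewrite (_ : [set x | _] = set0) ?measure0//.
    apply/seteqP; split => x //=; apply/negP; rewrite -leNgt.
    by rewrite (le_trans (ltW r0))// gauge_norm_ge0.
  rewrite -QP//.
  have -> : `]-oo, r[%classic = `]-oo, 0%R[%classic `|` [set s | (0 <= s < r)%R].
    apply/seteqP; split => s /=; rewrite !in_itv/=.
      by move=> sr; have [s0|s0] := ltP s 0%R; [left|right].
    by move=> [s0|/andP[]//]; exact: lt_le_trans s0 r0.
  have -> : [set s | (0 <= s < r)%R] = `[0%R, r[%classic.
    by apply/seteqP; split => s /=; rewrite in_itv.
  rewrite setUC measureU0//; apply: Qneg => //.
  by move=> s /=; rewrite in_itv/= /ray/= ltNge => /negP.
- by move=> n; rewrite -ge0_fin_numE//; exact: fin_num_measure.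
by rewrite RGenInftyO.measurableE in mA.
Qed.

Lemma ge0_integral_gauge (f : R -> \bar R) : measurable_fun (ray 0%R) f ->
  (forall r, (0 <= r)%R -> 0 <= f r) ->
  \int[P]_x f (gauge_norm K x) = \int[Q]_(r in ray 0%R) f r.
Proof.
move=> mf f0.
transitivity (\int[pushforward P g]_(r in ray 0%R) f r).
  rewrite ge0_integral_pushforward//; last 2 first.
  - exact: measurable_gauge_norm.
  - by move=> r; rewrite inE; exact: f0.
  rewrite (_ : _ @^-1` _ = setT)//.
  by apply/seteqP; split => x //= _; exact: gauge_norm_ge0.
apply: eq_measure_integral => [|? A mA _].
  exact: measurable_gauge_norm.
exact: esym (gauge_distribution_unique mA).
Qed.

Lemma integral_gauge phi : ray_concave 0 phi ->
  \int[P]_x phi (gauge_norm K x) = \int[Q]_(r in ray 0%R) phi r.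
Proof.
move=> rc; have mphi := measurable_ray_concave rc.
rewrite integralE [RHS]integralE; congr (_ - _).
  rewrite -(@ge0_integral_gauge phi^\+)//; last exact: measurable_funepos.
  by apply: eq_integral => x _; rewrite !funeposE.
rewrite -(@ge0_integral_gauge phi^\-)//; last exact: measurable_funeneg.
by apply: eq_integral => x _; rewrite !funenegE.
Qed.

Lemma calL_gauge phi : Phi phi -> calL K phi P = L K 0 phi Q.
Proof. by move=> /Phi_ray_concave rc; rewrite /calL /L integral_gauge. Qed.

Lemma class_Q_gauge : class_P K P -> class_Q 0 Q.
Proof.
move=> [Pint P0]; split => //.
  rewrite -ge0_integral_gauge//; exact: measurable_funTS.
rewrite gauge_distribution_unique// /pushforward.
rewrite (_ : _ @^-1` _ = [set 0%R])//.
rewrite -(gauge_norm_le0 hK); apply/seteqP; split => x /=; first by move=> ->.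
by move=> x0; apply/eqP; rewrite eq_le x0 gauge_norm_ge0.
Qed.

End gauge_distribution.

Theorem proposition4 (R : realType) (p : nat) (p_gt0 : (0 < p)%N)
    (K : set 'rV[R]_p) (hK : convex_body K) :
  (forall (a : R) (Q : probability (measurableTypeR R) R),
    (0 <= a)%R -> prob_on_ray a Q ->
    [/\ \int[Q]_(r in ray a) r%:E = +oo ->
          forall phi, Phi_ a phi -> L K a phi Q = -oo,
        Q [set a] = 1 ->
          ereal_sup [set L K a phi Q | phi in Phi_ a] = +oo &
        class_Q a Q ->
          ereal_sup [set L K a phi Q | phi in Phi_ a] \is a fin_num /\
          argmax (Phi_ a) (fun phi => L K a phi Q) = [set phi_star K a Q]])
  /\
  (forall P : probability (borel_rV R p) R,
    (exists Q : probability (measurableTypeR R) R,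
       prob_on_ray 0 Q /\
       forall r : R, (0 <= r)%R ->
         Q [set s | (0 <= s < r)%R] = P [set x | (gauge_norm K x < r)%R]) /\
    (forall Q : probability (measurableTypeR R) R,
       prob_on_ray 0 Q ->
       (forall r : R, (0 <= r)%R ->
         Q [set s | (0 <= s < r)%R] = P [set x | (gauge_norm K x < r)%R]) ->
       (forall phi, Phi phi -> calL K phi P = L K 0 phi Q) /\
       (class_P K P ->
          [/\ class_Q 0 Q,
              argmax Phi (fun phi => calL K phi P) = [set varphi_star K P] &
              varphi_star K P = phi_star K 0 Q]))).
Proof.
have [Kcompact _ K0] := hK.
have [c c0 Kc] : exists2 c : R, (0 < c)%R & p%:R%:E * lebesgue_outer K = c%:E.
  have := lebesgue_outer_gt0 K0; have := lebesgue_outer_lty p_gt0 Kcompact.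
  case: (lebesgue_outer K) => [v| |]// _; rewrite lte_fin => v0.
  by exists (p%:R * v)%R => //; rewrite mulr_gt0 ?ltr0n.
split=> [a Q a0 Qa|P].
  split=> [Qr phi /Phi_aP rc|Q1|[_ Qr Q1]].
  - exact: (L_infinite_mean p_gt0 a0 Qa c0 Kc).
  - exact: (L_sup_dirac a0 Qa c0 Kc).
  - split; first exact: (L_sup_fin p_gt0 a0 Qa c0 Kc).
    exact: (argmax_L_phi_star p_gt0 a0 Qa c0 Kc).
split=> [|Q Q0 QP]; first exact: exists_gauge_distribution.
have calLE := calL_gauge hK Q0 QP; split=> // /(class_Q_gauge hK Q0 QP) Qclass.
have argmaxE : argmax Phi (fun phi => calL K phi P) =
    argmax (Phi_ 0) (fun phi => L K 0 phi Q).
  rewrite Phi_0E; apply/seteqP; split => phi [phiP maxphi]; split=> // psi psiP;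
    by have := maxphi _ psiP; rewrite !calLE.
have starE : varphi_star K P = phi_star K 0 Q.
  by rewrite /varphi_star argmaxE.
split=> //; rewrite argmaxE starE; have [_ Qr Q1] := Qclass.
exact: (argmax_L_phi_star p_gt0 (lexx _) Q0 c0 Kc).
Qed.
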